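(* Let $n\ge2$, $\mathbb{R}_+=[0,+\infty)$, and let $p_1\equiv C_0$ be a complex constant and $p_j\in L_{1,loc}(\mathbb{R}_+)$, $j=2,\ldots,n$, complex-valued functions. Let $$l(y)=y^{(n)}+\sum_{j=1}^n p_j\,y^{(n-j)},$$ $$\mathscr{D}_0=\{y\in L_2(\mathbb{R}_+):\ y,y',\ldots,y^{(n-1)}\in AC_{loc}(\mathbb{R}_+),\ l(y)\in L_2(\mathbb{R}_+),\ y(0)=\ldots=y^{(n-1)}(0)=0,\ \exists x_0>0\ \forall x\ge x_0\ y(x)=0\},$$ and let $L_0$ be the operator in $L_2(\mathbb{R}_+)$ with domain $\mathscr{D}_0$ acting by $L_0y=l(y)$. If $L_0$ has an extension with compact resolvent, then for every infinite system of pairwise disjoint intervals $D_k\subset\mathbb{R}_+$ of equal length, $$\int_{D_k}\sum_{j=2}^n|p_j(x)|\,dx\to+\infty\quad\text{as } k\to\infty.$$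
   Context: $AC_{loc}(\mathbb{R}_+)$ denotes functions absolutely continuous on every compact subinterval of $[0,+\infty)$. An extension of $L_0$ is an operator $L\supset L_0$ in $L_2(\mathbb{R}_+)$; it has compact resolvent if its resolvent set is nonempty and its resolvent is a compact operator. *)

(* Defs.v *)
From HB Require Import structures.
From mathcomp Require Import all_boot all_order all_algebra.
From mathcomp Require Import all_classical all_reals all_analysis.
From mathcomp Require Import complex.
Set Implicit Arguments. Unset Strict Implicit. Unset Printing Implicit Defensive.
Import Order.TTheory GRing.Theory Num.Theory.
Local Open Scope classical_set_scope.
Local Open Scope ring_scope.

Section Defs.
Variable R : realType.
Local Notation C := (R[i]).
Local Notation mu := (@lebesgue_measure R).

Definition Rplus : set R := `[0, +oo[.

Definition cmod (z : C) : R := Num.sqrt (complex.Re z ^+ 2 + complex.Im z ^+ 2).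

Definition cmeasurable (D : set R) (f : R -> C) :=
  measurable_fun D (fun x => complex.Re (f x)) /\ measurable_fun D (fun x => complex.Im (f x)).

Definition l2sq (f : R -> C) : \bar R :=
  (\int[mu]_(x in Rplus) ((cmod (f x)) ^+ 2)%:E)%E.

Definition L2 (f : R -> C) := cmeasurable Rplus f /\ (l2sq f < +oo)%E.

Definition L1loc (f : R -> C) := forall b : R, 0 <= b ->
  cmeasurable `[0, b] f /\ (\int[mu]_(x in `[0%R, b]) (cmod (f x))%:E < +oo)%E.

Definition aeeq (f g : R -> C) := f = g %[ae mu in Rplus].

Definition abs_cont (a b : R) (f : R -> C) :=
  forall e : R, 0 < e -> exists2 d : R, 0 < d &
    forall (k : nat) (u v : nat -> R),
      (forall i, (i < k)%N -> a <= u i /\ u i <= v i /\ v i <= b) ->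
      (forall i j, (i < j < k)%N -> v i <= u j) ->
      \sum_(i < k) (v i - u i) < d ->
      \sum_(i < k) cmod (f (v i) - f (u i)) < e.

Definition ACloc (f : R -> C) := forall b : R, 0 <= b -> abs_cont 0 b f.

Definition deriv_ae (f g : R -> C) :=
  {ae mu, forall x, Rplus x ->
     is_derive x (1 : R) (fun t => complex.Re (f t)) (complex.Re (g x)) /\
     is_derive x (1 : R) (fun t => complex.Im (f t)) (complex.Im (g x))}.

(** l(y) = y^(n) + sum_{j=1}^n p_j y^(n-j), where ys k stands for y^(k) *)
Definition lexpr (n : nat) (p : nat -> R -> C) (ys : nat -> R -> C) : R -> C :=
  fun x => ys n x + \sum_(1 <= j < n.+1) p j x * ys (n - j)%N x.

Definition D0 (n : nat) (p : nat -> R -> C) (y : R -> C) (ys : nat -> R -> C) :=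
  [/\ L2 y, ys 0%N = y,
      (forall k, (k < n)%N -> ACloc (ys k) /\ deriv_ae (ys k) (ys k.+1)),
      L2 (lexpr n p ys) &
      (forall k, (k < n)%N -> ys k 0 = 0) /\
      exists2 x0 : R, 0 < x0 & forall x, x0 <= x -> y x = 0].

(** graph of L_0 (as a relation on representatives of L2 classes) *)
Definition graphL0 (n : nat) (p : nat -> R -> C) : set ((R -> C) * (R -> C)) :=
  fun fg => exists y ys, [/\ D0 n p y ys, L2 fg.1, L2 fg.2,
                            aeeq fg.1 y & aeeq fg.2 (lexpr n p ys)].

Definition is_operator (G : set ((R -> C) * (R -> C))) :=
  [/\ (forall f g, G (f, g) -> L2 f /\ L2 g),
      (forall f g f' g', G (f, g) -> L2 f' -> L2 g' -> aeeq f f' -> aeeq g g' ->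
           G (f', g')),
      G (fun=> 0, fun=> 0),
      (forall f1 g1 f2 g2 (c : C), G (f1, g1) -> G (f2, g2) ->
           G (fun x => f1 x + c * f2 x, fun x => g1 x + c * g2 x)) &
      (forall f g1 g2, G (f, g1) -> G (f, g2) -> aeeq g1 g2)].

(** the operator with graph G has compact resolvent: some lambda is in the
    resolvent set and (L - lambda)^{-1} is compact *)
Definition compact_resolvent (G : set ((R -> C) * (R -> C))) :=
  exists (lam : C) (Rl : (R -> C) -> (R -> C)),
  [/\ (forall g, L2 g -> L2 (Rl g) /\ G (Rl g, fun x => g x + lam * Rl g x)),
      (forall f, G (f, fun x => lam * f x) -> aeeq f (fun=> 0)) &
      (forall gs : nat -> R -> C, (forall m, L2 (gs m)) ->
         (exists M : R, forall m, (l2sq (gs m) <= M%:E)%E) ->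
         exists phi : nat -> nat, (forall m, (phi m < phi m.+1)%N) /\
           exists2 h, L2 h &
             l2sq (fun x => Rl (gs (phi m)) x - h x) @[m --> \oo] --> 0%E)].

End Defs.

(* Main.v *)
Require Import Defs.
From HB Require Import structures.
From mathcomp Require Import all_boot all_order all_algebra.
From mathcomp Require Import all_classical all_reals all_analysis.
From mathcomp Require Import measurable_realfun complex.
From mathcomp Require Import zify ring lra.
Import Order.TTheory GRing.Theory Num.Theory.
Import numFieldNormedType.Exports.
Local Open Scope classical_set_scope.
Local Open Scope ring_scope.

(** Suppose the integrals over infinitely many of the intervals stay bounded. Repeated
    halving gives, in each of these intervals, a subinterval [[v, v + d]] of one common
    length [d] on which the integral of all the [|p_j|] is as small as we like. There
    [l] is a small perturbation of the [n]-th derivative, so a fixed polynomial bump,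
    transplanted to the subinterval, can be corrected by a contraction argument into a
    function [y] on which [l(y)] is a bounded combination of polynomials.
    Adding multiples of fixed polynomials keeps all derivatives of order less than [n]
    equal to zero at both ends, so [y] extended by zero lies in the domain of [L_0].
    We obtain functions with disjoint supports, with [l(y)] bounded and [y] bounded away
    from zero in L2; as [y] is the image of [l(y) - lam y] under the resolvent of any
    extension of [L_0], this resolvent is not compact. *)

(** * Primitives of integrable functions *)

Section Primitive.
Set Implicit Arguments.
Unset Strict Implicit.
Context {R : realType}.
Notation mu := (@lebesgue_measure R).
Implicit Types (f g : R -> R).

Definition L1 f := mu.-integrable setT (EFin \o f).

(** The primitive starts at minus infinity, so for a function supported in [[a, b]] it automatically
    has zero initial data at [a]. *)
Definition J f (x : R) := \int[mu]_(t in `]-oo, x]) f t.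

Lemma L1_itv f (i : interval R) : L1 f -> mu.-integrable [set` i] (EFin \o f).
Proof. by move=> /integrableS; apply => //; exact: measurable_itv. Qed.
Arguments L1_itv {f i}.

Lemma L1_meas f : L1 f -> measurable_fun setT f.
Proof. by move=> /measurable_int /measurable_EFinP. Qed.

Lemma L1D f g : L1 f -> L1 g -> L1 (fun x => f x + g x).
Proof. by move=> fi gi; apply: eq_integrable (integrableD _ fi gi). Qed.

Lemma L1Z c f : L1 f -> L1 (fun x => c * f x).
Proof. by move=> fi; apply: eq_integrable (integrableZl _ c fi). Qed.

Lemma L1B f g : L1 f -> L1 g -> L1 (fun x => f x - g x).
Proof. by move=> fi gi; apply: eq_integrable (integrableB _ fi gi). Qed.

Lemma L1_abs f : L1 f -> L1 (fun x => `|f x|).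
Proof. exact: integrable_norm. Qed.

Lemma integrable_sumr (D : set R) (I : eqType) (s : seq I) (F : I -> R -> R) :
  measurable D ->
  (forall i, i \in s -> mu.-integrable D (EFin \o F i)) ->
  mu.-integrable D (EFin \o (fun x => \sum_(i <- s) F i x)).
Proof.
move=> mD; elim: s => [_|i s ih h].
  by apply: eq_integrable (integrable0 _ _) => // x _ /=; rewrite big_nil.
have h1 : mu.-integrable D ((EFin \o F i) \+ (EFin \o (fun x => \sum_(j <- s) F j x)%R))%E.
  apply: integrableD => //; first by apply: h; rewrite mem_head.
  by apply: ih => j js; apply: h; rewrite in_cons js orbT.
by apply: eq_integrable h1 => // x _ /=; rewrite big_cons.
Qed.

Lemma L1_sum (I : eqType) (s : seq I) (F : I -> R -> R) :
  (forall i, i \in s -> L1 (F i)) -> L1 (fun x => \sum_(i <- s) F i x).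
Proof. exact: integrable_sumr. Qed.

Lemma JD f g x : L1 f -> L1 g -> J (fun t => f t + g t) x = J f x + J g x.
Proof. by move=> fi gi; rewrite /J RintegralD//; exact: L1_itv. Qed.

Lemma JB f g x : L1 f -> L1 g -> J (fun t => f t - g t) x = J f x - J g x.
Proof. by move=> fi gi; rewrite /J RintegralB//; exact: L1_itv. Qed.

Lemma JZ c f x : L1 f -> J (fun t => c * f t) x = c * J f x.
Proof. by move=> fi; rewrite /J RintegralZl//; exact: L1_itv. Qed.

Lemma J_sum (I : eqType) (s : seq I) (F : I -> R -> R) x :
  (forall i, i \in s -> L1 (F i)) ->
  J (fun t => \sum_(i <- s) F i t) x = \sum_(i <- s) J (F i) x.
Proof.
elim: s => [_|i s ih h].
  rewrite big_nil /J; under eq_Rintegral do rewrite big_nil.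
  by rewrite Rintegral_cst// mul0r.
rewrite big_cons /J; under eq_Rintegral do rewrite big_cons.
rewrite -/(J _ x) JD ?ih//.
- by move=> j js; apply: h; rewrite in_cons js orbT.
- by apply: h; rewrite mem_head.
- by apply: L1_sum => j js; apply: h; rewrite in_cons js orbT.
Qed.

Lemma J_sub f u v : L1 f -> u <= v ->
  J f v - J f u = \int[mu]_(t in `]u, v]) f t.
Proof. by move=> fi uv; rewrite /J Rintegral_itvB//; exact: L1_itv. Qed.

Lemma lebesgue_measure_oc u v : u <= v -> mu `]u, v] = (v - u)%:E.
Proof.
move=> uv; rewrite lebesgue_measure_itv/= lte_fin.
by move: uv; rewrite le_eqVlt => /predU1P[->|->//]; rewrite ltxx subrr.
Qed.

Lemma J_ge0 f x : (forall t, 0 <= f t) -> 0 <= J f x.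
Proof. by move=> f0; exact: Rintegral_ge0. Qed.

Lemma le_J f u v : L1 f -> (forall t, 0 <= f t) -> u <= v -> J f u <= J f v.
Proof.
by move=> fi f0 uv; rewrite -subr_ge0 J_sub//; exact: Rintegral_ge0.
Qed.

Lemma normr_J f x : L1 f -> `|J f x| <= J (fun t => `|f t|) x.
Proof. by move=> fi; apply: le_normr_Rintegral => //; exact: L1_itv. Qed.

Lemma J_le_int f x : L1 f -> (forall t, 0 <= f t) -> J f x <= \int[mu]_t f t.
Proof.
move=> fi f0; rewrite /J /Rintegral fine_le//.
- by apply: integrable_fin_num => //; exact: L1_itv.
- by apply: integrable_fin_num.
apply: ge0_subset_integral => //; first by apply/measurable_EFinP; exact: L1_meas.
by move=> y _; rewrite lee_fin.
Qed.

Lemma J_ae_derive f : L1 f ->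
  {ae mu, forall x, is_derive x (1 : R) (J f) (f x)}.
Proof.
move=> fi.
have li : locally_integrable [set: R] f.
  apply: open_integrable_locally => //; exact: openT.
have := FTC1Ny (fun y => L1_itv fi) li.
apply: filterS; first exact: (ae_filter_ringOfSetsType mu).
move=> x /= [dx dE].
apply: DeriveDef; first exact: dx.
by rewrite -derive1E; exact: dE.
Qed.

(* Truncating [f] at height [K], the part below [K] contributes at most [K] times
   the total length and the rest contributes at most its whole integral. *)
Lemma J_abs_cont f : L1 f -> forall e : R, 0 < e -> exists2 d : R, 0 < d &
    forall (k : nat) (u v : nat -> R),
      (forall i, (i < k)%N -> u i <= v i) ->
      (forall i j, (i < j < k)%N -> v i <= u j) ->
      \sum_(i < k) (v i - u i) < d ->
      \sum_(i < k) `|J f (v i) - J f (u i)| < e.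
Proof.
move=> fi e e0.
pose T (K : nat) (t : R) : R := Num.max (`|f t| - K%:R) 0.
have TM K : measurable_fun setT (T K).
  apply: measurable_maxr; last exact: measurable_cst.
  apply: measurable_funB; last exact: measurable_cst.
  by apply: measurableT_comp; [exact: normr_measurable|exact: L1_meas].
have T0 K t : 0 <= T K t by rewrite /T le_max lexx orbT.
have Tf K t : T K t <= `|f t|.
  by rewrite /T ge_max normr_ge0 andbT lerBlDr lerDl.
have TL K : L1 (T K).
  apply: (@le_integrable _ _ _ mu _ measurableT _ (EFin \o f)) fi.
    by apply/measurable_EFinP; exact: TM.
  by move=> t _; rewrite lee_fin/= ger0_norm.
(* Dominated convergence: at each point [T K t] is zero as soon as [K] exceeds [|f t|], and [|f|]
   dominates. *)
have Tcv : (\int[mu]_t (T K t)%:E)%E @[K --> \oo] --> (\int[mu]_t (cst 0%R t)%:E)%E.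
  apply: (@dominated_cvg _ _ _ mu setT measurableT (fun K t => (T K t)%:E)
    (fun t => (cst (0 : R) t)%:E) (fun t => (`|f t|)%:E)).
  - by move=> K; apply/measurable_EFinP; exact: TM.
  - move=> t _; apply: cvg_near_cst.
    near=> K; congr EFin; apply: max_r.
    rewrite subr_le0; near: K.
    exact: nbhs_infty_ger.
  - by [].
  - exact: L1_abs.
  - by move=> K t _ /=; rewrite lee_fin ger0_norm.
have [K HK] : exists K, (\int[mu]_t T K t < e / 2).
  rewrite integral0 in Tcv; move/fine_cvgP : Tcv => [_ /cvgrPdist_lt/(_ (e / 2))].
  rewrite divr_gt0// => /(_ isT) [K _ /(_ K (leqnn _))] /=.
  rewrite sub0r normrN => h; exists K; apply: le_lt_trans h; exact: ler_norm.
(* The part below height [K] then contributes at most [e / 2]; adding 1 keeps the denominator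
   positive when [K] is 0. *)
exists (e / 2 / (K%:R + 1)); first by rewrite !divr_gt0// ltr_wpDl.
move=> k u v uv vu sd.
have step i : (i < k)%N ->
    `|J f (v i) - J f (u i)| <= K%:R * (v i - u i) + (J (T K) (v i) - J (T K) (u i)).
  move=> ik; rewrite !J_sub ?uv//.
  apply: le_trans (le_normr_Rintegral _ (L1_itv fi)) _ => //.
  have cI : mu.-integrable `]u i, v i] (EFin \o cst K%:R).
    apply: measurable_bounded_integrable.
    - exact: measurable_itv.
    - by have := lebesgue_measure_oc (uv _ ik); rewrite /= => ->; rewrite ltry.
    - exact: measurable_cst.
    by exists K%:R; split => // x xK y _ /=; rewrite ger0_norm ?ler0n// ltW.
  have -> : K%:R * (v i - u i) = \int[mu]_(t in `]u i, v i]) cst K%:R t.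
    rewrite Rintegral_cst; last exact: measurable_itv.
    by have := lebesgue_measure_oc (uv _ ik); rewrite /= => ->.
  rewrite -RintegralD//; last exact: L1_itv.
  apply: le_Rintegral => //.
  - exact: L1_itv (L1_abs fi).
  - by apply: eq_integrable (integrableD _ cI (L1_itv (TL K))).
  - by move=> t _ /=; rewrite /T -lerBlDl le_max lexx.
(* [J (T K)] is nondecreasing, so its increments over the gaps between consecutive intervals are
   nonnegative and the sum telescopes. *)
have tele m : (m < k)%N -> \sum_(i < m.+1) (J (T K) (v i) - J (T K) (u i)) <= J (T K) (v m).
  elim: m => [k0|m ih mk].
    by rewrite big_ord_recr big_ord0/= add0r lerBlDr lerDl J_ge0.
  rewrite big_ord_recr/=; have := ih (ltnW mk).
  have : J (T K) (v m) <= J (T K) (u m.+1) by apply: le_J => //; rewrite vu// ltnSn.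
  lra.
have tele' : \sum_(i < k) (J (T K) (v i) - J (T K) (u i)) <= \int[mu]_t T K t.
  case: k {uv vu sd step} tele => [_|k tele].
    by rewrite big_ord0 Rintegral_ge0.
  by apply: le_trans (tele _ (ltnSn k)) _; exact: J_le_int.
apply: (@le_lt_trans _ _ (\sum_(i < k) (K%:R * (v i - u i) + (J (T K) (v i) - J (T K) (u i))))).
  by apply: ler_sum => i _; exact: step.
rewrite big_split/= -mulr_sumr [ltRHS](splitr e); apply: ler_ltD; last first.
  exact: le_lt_trans HK.
have : (K%:R + 1) * (\sum_(i < k) (v i - u i)) <= e / 2.
  by rewrite mulrC -ler_pdivlMr ?ltr_wpDl// ltW.
have : 0 <= \sum_(i < k) (v i - u i) by apply: sumr_ge0 => i _; rewrite subr_ge0 uv.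
rewrite mulrDl mul1r; lra.
Unshelve. all: by end_near. Qed.

Lemma J_continuous f : L1 f -> continuous (J f).
Proof.
move=> fi x; apply/cvgrPdist_lt => e e0.
have [d d0 H] := J_abs_cont fi e0.
have dist u v : u <= v -> v - u < d -> `|J f v - J f u| < e.
  move=> uv vud; have := H 1%N (fun=> u) (fun=> v).
  rewrite !big_ord_recr !big_ord0/= !add0r; apply => //.
  by move=> i j; rewrite ltnS => /andP[ij]; case: j ij.
have : \forall y \near x, `|x - y| < d by exact: near_ball.
apply: filterS => y xyd; have [xy|/ltW yx] := leP x y.
  by rewrite distrC; apply: dist => //; rewrite (le_lt_trans _ xyd)// distrC ler_norm.
by apply: dist => //; rewrite (le_lt_trans _ xyd)// ler_norm.
Qed.

End Primitive.

(** * Interpolation and bump polynomials *)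

Section Hermite.
Context {R : realType}.
Set Implicit Arguments.
Unset Strict Implicit.
Implicit Types (p q : {poly R}) (c : R).

(** One differentiation turns a multiple of [('X - c%:P) ^+ n.+1] into a multiple of
    [('X - c%:P) ^+ n], so the root survives fewer than [n] differentiations. *)
Lemma derivn_root_mul c n k q : (k < n)%N ->
  ((('X - c%:P) ^+ n * q)^`(k)).[c] = 0.
Proof.
elim: k n q => [|k ih] [//|n] q kn.
  by rewrite /= hornerM horner_exp hornerXsubC subrr expr0n mul0r.
rewrite derivSn derivM deriv_exp/= derivXsubC mul1r.
rewrite (_ : _ + _ = ('X - c%:P) ^+ n * (q *+ n.+1 + ('X - c%:P) * q^`())).
  exact: ih.
by rewrite [RHS]mulrDr mulrnAl mulrnAr exprSr mulrA.
Qed.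

Lemma derivn_XsubC_exp c i k :
  (('X - c%:P) ^+ i)^`(k) = ('X - c%:P) ^+ (i - k) *+ i ^_ k.
Proof.
elim: k => [|k ih]; first by rewrite subn0 ffactn0 mulr1n.
rewrite derivnS ih derivMn deriv_exp derivXsubC mul1r -mulrnA ffactnSr.
by rewrite mulnC subnS.
Qed.

(** ['X ^+ n] and [('X - 1%:P) ^+ n] are coprime, so the derivatives at 0 and at 1 can be prescribed
    independently. The polynomials [E i] will cancel unwanted data at the right end without
    disturbing the left end. *)
Lemma hermite_end n : exists E : nat -> {poly R}, forall i k, (i < n)%N -> (k < n)%N ->
  ((E i)^`(k)).[0] = 0 /\ ((E i)^`(k)).[1] = (i == k)%:R.
Proof.
have : coprimep ('X ^+ n : {poly R}) (('X - 1%:P) ^+ n).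
  apply/coprimep_expl/coprimep_expr.
  by rewrite -[X in coprimep X _]subr0 coprimep_XsubC2// subr0 oner_eq0.
case/Bezout_eq1_coprimepP => -[u v]/= uv.
(* Modulo X^n this polynomial is 0 and modulo (X - 1)^n it is (X - 1)^i / i!. *)
exists (fun i => (i`!%:R)^-1 *: ('X ^+ n * (u * ('X - 1%:P) ^+ i))) => i k iln kln; split.
  rewrite derivnZ hornerZ -[X in X ^+ n]subr0 -[X in _ - X]/(0%:P).
  by rewrite derivn_root_mul ?mulr0.
have -> : 'X ^+ n * (u * ('X - 1%:P) ^+ i) =
    ('X - 1%:P) ^+ i - ('X - 1%:P) ^+ n * (v * ('X - 1%:P) ^+ i).
  have -> : 'X ^+ n * (u * ('X - 1%:P) ^+ i) = (u * 'X^n) * ('X - 1%:P) ^+ i by ring.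
  by rewrite -[u * _](addrK (v * ('X - 1%:P) ^+ n)) uv; ring.
rewrite derivnZ derivnB hornerZ hornerD hornerN derivn_root_mul// subr0.
rewrite derivn_XsubC_exp hornerMn horner_exp hornerXsubC subrr expr0n.
have [->|ik] := eqVneq i k.
  by rewrite subnn eqxx ffactnn mulVf// pnatr_eq0 -lt0n fact_gt0.
case: (ltngtP i k) ik => // ik _; first by rewrite ffact_small// mulr0n mulr0.
by rewrite subn_eq0 leqNgt ik mul0rn mulr0.
Qed.

Lemma poly_bounded p : exists2 K : R, 0 <= K & forall s, 0 <= s <= 1 -> `|p.[s]| <= K.
Proof.
exists (\sum_(i < size p) `|p`_i|); first by apply: sumr_ge0.
move=> s /andP[s0 s1]; rewrite horner_coef; apply: le_trans (ler_norm_sum _ _ _) _.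
apply: ler_sum => i _; rewrite normrM ler_piMr// ger0_norm ?exprn_ge0//.
by rewrite exprn_ile1.
Qed.

(** The sum of the individual bounds serves for all indices at once. The order [n] is included
    because the top derivative enters [l(y)]. *)
Lemma derivn_bounded (E : nat -> {poly R}) n : exists2 K : R, 0 <= K &
  forall i k s, (i < n)%N -> (k <= n)%N -> 0 <= s <= 1 -> `|((E i)^`(k)).[s]| <= K.
Proof.
have [K hK] : {K : nat -> nat -> R & forall i k, 0 <= K i k /\
    forall s, 0 <= s <= 1 -> `|((E i)^`(k)).[s]| <= K i k}.
  have h i k := cid2 (poly_bounded ((E i)^`(k))).
  by exists (fun i k => projT1 (h i k)) => i k; case: (h i k).
exists (\sum_(i < n) \sum_(k < n.+1) K i k).
  by apply: sumr_ge0 => i _; apply: sumr_ge0 => k _; exact: (hK _ _).1.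
move=> i k s iln kln s01; apply: le_trans ((hK i k).2 s s01) _.
rewrite (bigD1 (Ordinal iln))//= (bigD1 (Ordinal (kln : (k < n.+1)%N)))//= -addrA lerDl.
apply: addr_ge0; first by apply: sumr_ge0 => j _; exact: (hK _ _).1.
by apply: sumr_ge0 => j _; apply: sumr_ge0 => l _; exact: (hK _ _).1.
Qed.

Lemma bump_poly n : exists2 Y : {poly R},
  forall k, (k < n)%N -> (Y^`(k)).[0] = 0 /\ (Y^`(k)).[1] = 0 &
  exists2 c : R, 0 < c & forall s, 1 / 4 <= s <= 3 / 4 -> c <= Y.[s].
Proof.
(* It has zeros of order [n] at both ends, and on the middle half both [s] and [1 - s] are at least
   [1 / 4]. *)
exists ('X ^+ n * (1 - 'X) ^+ n).
  move=> k kn; split.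
    by rewrite -[X in X ^+ n * _]subr0 -[X in _ - X]/(0%:P) derivn_root_mul.
  have -> : 'X ^+ n * (1 - 'X) ^+ n = ('X - 1%:P) ^+ n * ((-1) ^+ n * 'X ^+ n) :> {poly R}.
    by rewrite polyC1 -[1 - 'X]opprB [(- ('X - 1)) ^+ n]exprNn [LHS]mulrC mulrAC mulrC.
  by rewrite derivn_root_mul.
exists ((1 / 4) ^+ n * (1 / 4) ^+ n); first by rewrite mulr_gt0// exprn_gt0//; lra.
move=> s hs; rewrite hornerM !horner_exp !hornerE.
by rewrite ler_pM// ?exprn_ge0 ?lerXn2r ?nnegrE//; lra.
Qed.

End Hermite.

(** * Iterated primitives vanishing at both ends *)

Section Corrector.
Context {R : realType}.
Set Implicit Arguments.
Unset Strict Implicit.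
Notation mu := (@lebesgue_measure R).
Implicit Types (f g : R -> R) (P : {poly R}).

Lemma Rintegral_eq0 (A : set R) f : (forall x, A x -> f x = 0) ->
  \int[mu]_(x in A) f x = 0.
Proof.
move=> f0; rewrite /Rintegral (eq_integral (cst 0%E)) ?integral0//.
by move=> x; rewrite inE => /f0 ->.
Qed.

Lemma FTC_poly P u v : u < v -> \int[mu]_(x in `[u, v]) P^`().[x] = P.[v] - P.[u].
Proof.
move=> uv; have dP x := is_derive_poly P x.
have cP : continuous (horner P) := @continuous_horner _ P.
rewrite /Rintegral (@continuous_FTC2 _ (horner P^`()) (horner P))//.
- exact/continuous_subspaceT/continuous_horner.
- split.
  + by move=> x _; have [] := dP x.
  + exact/cvg_at_right_filter/cP.
  + exact/cvg_at_left_filter/cP.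
- by move=> x _; rewrite derive1E; have [] := dP x.
Qed.

Variables (a b : R).
Hypothesis ab : a < b.
Let d := b - a.
Let d0 : 0 < d. Proof. by rewrite subr_gt0. Qed.

Definition supp f := forall x, ~~ (a <= x <= b) -> f x = 0.

Definition window f x := if a <= x <= b then f x else 0.

Lemma window_supp f : supp (window f).
Proof. by move=> x /negbTE xab; rewrite /window xab. Qed.

Lemma windowE f : window f = f \_ `[a, b].
Proof.
apply/funext => x; rewrite /window patchE.
suff -> : (x \in `[a, b]%classic) = (a <= x <= b) by [].
by apply/idP/idP; rewrite inE/= in_itv/=.
Qed.

Lemma window_meas f : measurable_fun `[a, b] f -> measurable_fun setT (window f).
Proof. by move=> mf; rewrite windowE; exact: (measurable_restrictT _ (measurable_itv _)).1. Qed.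

Lemma supp_window f : supp f -> window f = f.
Proof. by move=> sf; apply/funext => x; rewrite /window; case: ifPn => // /sf. Qed.

Lemma J_lt_supp f x : supp f -> x < a -> J f x = 0.
Proof.
move=> sf xa; apply: Rintegral_eq0 => t /=; rewrite in_itv/= => tx; apply: sf.
by rewrite negb_and -ltNge (le_lt_trans tx xa).
Qed.

Lemma J_gt_supp f x : L1 f -> supp f -> b <= x -> J f x = J f b.
Proof.
move=> fi sf bx; apply/eqP; rewrite -subr_eq0 J_sub//; apply/eqP/Rintegral_eq0 => t /=.
by rewrite in_itv/= => /andP[bt _]; apply: sf; rewrite negb_and -!ltNge bt orbT.
Qed.

Lemma J_supp f x : L1 f -> supp f -> a <= x -> J f x = \int[mu]_(t in `[a, x]) f t.
Proof.
move=> fi sf ax; rewrite -[LHS](subrK (J f a)) J_sub//.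
rewrite Rintegral_itv_obnd_cbnd; last exact: L1_itv.
rewrite [J f a]/J -Rintegral_itv_bndo_bndc; last exact: L1_itv.
rewrite [X in _ + X]Rintegral_eq0 ?addr0// => t/=; rewrite in_itv/= => ta.
by apply: sf; rewrite negb_and -ltNge ta.
Qed.

Lemma int_supp f : L1 f -> supp f -> \int[mu]_t f t = \int[mu]_(t in `[a, b]) f t.
Proof.
move=> fi sf; rewrite [RHS]Rintegral_mkcond; apply: eq_Rintegral => x _.
by rewrite -windowE supp_window.
Qed.

Lemma L1_bounded f K : measurable_fun setT f -> supp f ->
  (forall x, a <= x <= b -> `|f x| <= K) -> L1 f /\ \int[mu]_t `|f t| <= K * d.
Proof.
move=> mf sf fK.
have muab : mu `[a, b] = d%:E by rewrite lebesgue_measure_itv/= lte_fin ab.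
have iab : mu.-integrable `[a, b] (EFin \o f).
  apply: measurable_bounded_integrable.
  - exact: measurable_itv.
  - by move: muab; rewrite /= => ->; rewrite ltry.
  - exact: measurable_funTS.
  exists K; split; first by rewrite num_real.
  by move=> x Kx y /=; rewrite in_itv/= => yab; rewrite (le_trans (fK _ yab))// ltW.
have fi : L1 f.
  rewrite /L1 -(supp_window sf) windowE -restrict_EFin.
  by apply/(integrable_mkcond _ _).1.
split=> //; rewrite int_supp//; last first.
- by move=> x /sf ->; rewrite normr0.
- exact: L1_abs.
rewrite (_ : K * d = \int[mu]_(x in `[a, b]) cst K x).
  apply: le_Rintegral.
  - exact: measurable_itv.
  - exact: L1_itv (L1_abs fi).
  - apply: measurable_bounded_integrable.
    - exact: measurable_itv.
    - by move: muab; rewrite /= => ->; rewrite ltry.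
    - exact: measurable_cst.
    exists `|K|; split; first by rewrite num_real.
    by move=> x Kx y /= _; rewrite ltW.
  by move=> x /=; rewrite in_itv/= => /fK.
rewrite Rintegral_cst; last exact: measurable_itv.
by move: muab => /= ->.
Qed.

Definition pullback P := window (fun x => P.[(x - a) / d]).

Lemma itv01 x : a <= x <= b -> 0 <= (x - a) / d <= 1.
Proof.
move=> /andP[ax xb]; rewrite divr_ge0 ?subr_ge0//; last exact: ltW.
by rewrite ler_pdivrMr// mul1r lerD2r.
Qed.

Let comp P : {poly R} := P \Po (d^-1 *: ('X - a%:P)).

Let compE P x : (comp P).[x] = P.[(x - a) / d].
Proof. by rewrite horner_comp hornerZ hornerXsubC mulrC. Qed.

Lemma pullback_meas P : measurable_fun setT (pullback P).
Proof.
apply: window_meas; apply: measurable_funTS.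
rewrite (_ : (fun x => _) = horner (comp P)).
  by apply: continuous_measurable_fun; exact: continuous_horner.
by apply/funext => x; rewrite compE.
Qed.

Lemma pullback_L1 P : L1 (pullback P).
Proof.
have [K K0 PK] := poly_bounded P.
have [|//] := @L1_bounded (pullback P) K (pullback_meas P) (@window_supp _).
by move=> x xab; rewrite /pullback /window xab PK// itv01.
Qed.

Lemma J_pullback P x : a <= x <= b ->
  J (pullback P^`()) x = d * (P.[(x - a) / d] - P.[0]).
Proof.
move=> /andP[ax xb]; rewrite J_supp//; [|exact: pullback_L1|exact: window_supp].
move: ax; rewrite le_eqVlt => /predU1P[<-|ax].
  by rewrite set_itv1 Rintegral_set1 subrr mul0r subrr mulr0.
transitivity (\int[mu]_(t in `[a, x]) (d *: comp P)^`().[t]).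
  apply: eq_Rintegral => t; rewrite inE/= in_itv/= => /andP[at_ tx].
  rewrite /pullback /window at_ (le_trans tx xb)/=.
  rewrite derivZ deriv_comp derivZ derivXsubC hornerZ hornerM -/(comp _) compE.
  by rewrite hornerZ hornerC mulr1 mulrCA divff ?mulr1// gt_eqF.
by rewrite FTC_poly// !hornerZ !compE subrr mul0r mulrBr.
Qed.

(** Outside the interval the identity is automatic: to the left both sides vanish, and to the right
    [J g] keeps its value at [b], which is 0 because [f b = 0]. This is what permits extension by
    zero. *)
Lemma J_chain f g : L1 g -> supp f -> supp g -> f b = 0 ->
  (forall x, a <= x <= b -> f x = J g x / d) -> forall x, f x = J g x / d.
Proof.
move=> gi sf sg fb fg x; have [/fg//|xab] := boolP (a <= x <= b).
rewrite sf//; move: xab; rewrite negb_and -!ltNge => /orP[xa|bx].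
  by rewrite J_lt_supp// mul0r.
by rewrite J_gt_supp ?ltW// -fg ?lexx ?andbT ?ltW// fb.
Qed.

Lemma pullback_chain P : P.[0] = 0 -> P.[1] = 0 ->
  forall x, pullback P x = J (pullback P^`()) x / d.
Proof.
move=> P0 P1; apply: J_chain; rewrite ?pullback_L1//; try exact: window_supp.
  by rewrite /pullback /window lexx (ltW ab) divff ?gt_eqF.
move=> x xab; rewrite J_pullback// P0 subr0 mulrAC divff ?gt_eqF// mul1r.
by rewrite /pullback /window xab.
Qed.

(** The initial factor [d] cancels the first division by [d], so the first primitive is [J f]
    itself. The window is reapplied at each step because a primitive need not vanish to the right of
    [b]. *)
Fixpoint iterJ f (m : nat) : R -> R :=
  if m is m'.+1 then window (fun x => J (iterJ f m') x / d) else fun x => d * f x.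

Notation I f := (\int[mu]_t `|f t|).

Let I_ge0 f : 0 <= I f. Proof. exact: Rintegral_ge0. Qed.

Let normr_J_le f x : L1 f -> `|J f x| <= I f.
Proof.
move=> fi; apply: le_trans (normr_J _ fi) _.
by apply: J_le_int => //; exact: L1_abs.
Qed.

(** Integrating a bounded function over an interval of length [d] and dividing by [d] does not
    increase the bound, so the integral of [|f|] bounds every level. The bound starts at level 1,
    since [d * f] is merely integrable. *)
Lemma iterJP f : L1 f -> supp f -> forall m,
  [/\ L1 (iterJ f m), supp (iterJ f m) & forall x, `|iterJ f m.+1 x| <= I f].
Proof.
move=> fi sf; elim=> [|m [im sm bm]].
  split; first exact: L1Z.
    by move=> x /sf /= ->; rewrite mulr0.
  move=> x /=; rewrite /window; case: ifP => _; last by rewrite normr0.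
  by rewrite JZ// mulrAC divff ?gt_eqF// mul1r normr_J_le.
have mm : measurable_fun setT (iterJ f m.+1).
  apply: window_meas; apply: measurable_funTS; apply: measurable_funM; last first.
    exact: measurable_cst.
  by apply: continuous_measurable_fun; exact: J_continuous.
have [i1 le1] := L1_bounded mm (window_supp _) (fun x _ => bm x).
split; [exact: i1|exact: window_supp|].
move=> x; rewrite /= /window; case: ifP => _; last by rewrite normr0.
rewrite normrM normfV [ `|d|]gtr0_norm// ler_pdivrMr//.
exact: le_trans (normr_J_le _ i1) le1.
Qed.

Lemma iterJB f g : L1 f -> supp f -> L1 g -> supp g -> forall m x,
  iterJ (fun t => f t - g t) m x = iterJ f m x - iterJ g m x.
Proof.
move=> fi sf gi sg; elim=> [|m ih] x /=; first by rewrite mulrBr.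
rewrite /window; case: ifP => _; last by rewrite subr0.
have [iF _ _] := iterJP fi sf m; have [iG _ _] := iterJP gi sg m.
by rewrite (funext ih) JB// mulrBl.
Qed.

Variables (n : nat) (E : nat -> {poly R}).
Hypothesis n0 : (0 < n)%N.
Hypothesis EP : forall i k, (i < n)%N -> (k < n)%N ->
  ((E i)^`(k)).[0] = 0 /\ ((E i)^`(k)).[1] = (i == k)%:R.

(* With [f = d^(n-1) y^(n)], [iterJ f (n - k)] is the scaled derivative [d^k y^(k)] of the
   solution with zero data at [a]; the scaling keeps all bounds independent of [d].
   The polynomials [E i] cancel its derivatives at [b]. *)
Definition corrector f k x :=
  iterJ f (n - k) x - \sum_(i < n) iterJ f (n - i) b * pullback (E i)^`(k) x.

Lemma corrector_L1 f k : L1 f -> supp f -> L1 (corrector f k).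
Proof.
move=> fi sf; apply: L1B; first by have [] := iterJP fi sf (n - k).
by apply: L1_sum => i _; apply: L1Z; exact: pullback_L1.
Qed.

Lemma corrector_supp f k : L1 f -> supp f -> supp (corrector f k).
Proof.
move=> fi sf x xab; have [_ s _] := iterJP fi sf (n - k).
rewrite /corrector s// sub0r big1 ?oppr0// => i _.
by rewrite /pullback window_supp// mulr0.
Qed.

Lemma correctorB f g : L1 f -> supp f -> L1 g -> supp g -> forall k x,
  corrector (fun t => f t - g t) k x = corrector f k x - corrector g k x.
Proof.
move=> fi sf gi sg k x; rewrite /corrector iterJB//.
under eq_bigr do rewrite iterJB// mulrBl.
by rewrite sumrB; ring.
Qed.

Lemma corrector_end f k : (k < n)%N -> corrector f k b = 0.
Proof.
move=> kn; rewrite /corrector (bigD1 (Ordinal kn))//= big1 => [|i ik].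
  rewrite /pullback /window lexx (ltW ab) divff ?gt_eqF// (EP kn kn).2 eqxx mulr1 addr0.
  by rewrite subrr.
rewrite /pullback /window lexx (ltW ab) divff ?gt_eqF// (EP _ kn).2//.
by rewrite -(inj_eq val_inj)/= in ik; rewrite (negbTE ik) mulr0.
Qed.

(** On the interval the relation holds term by term, the [E i] having zero data at 0;
    [corrector_end] then lets [J_chain] extend it to the whole line. *)
Lemma corrector_chain f k : L1 f -> supp f -> (k < n)%N ->
  forall x, corrector f k x = J (corrector f k.+1) x / d.
Proof.
move=> fi sf kn; apply: J_chain.
- exact: corrector_L1.
- exact: corrector_supp.
- exact: corrector_supp.
- exact: corrector_end.
move=> x xab; have [i1 _ _] := iterJP fi sf (n - k.+1).
rewrite [in RHS]/corrector JB//; last first.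
  by apply: L1_sum => i _; apply: L1Z; exact: pullback_L1.
rewrite J_sum; last by move=> i _; apply: L1Z; exact: pullback_L1.
rewrite mulrBl mulr_suml /corrector; congr (_ - _).
  by rewrite -(subnSK kn)/= /window xab.
apply: eq_bigr => i _; rewrite JZ; last exact: pullback_L1.
rewrite derivnS J_pullback// (EP _ kn).1// subr0 -mulrA; congr (_ * _).
by rewrite mulrAC divff ?gt_eqF// mul1r /pullback /window xab.
Qed.

Variable K : R.
Hypothesis EK : forall i k s, (i < n)%N -> (k <= n)%N -> 0 <= s <= 1 ->
  `|((E i)^`(k)).[s]| <= K.

Let sum_bound f k x : L1 f -> supp f -> (k <= n)%N ->
  `|\sum_(i < n) iterJ f (n - i) b * pullback (E i)^`(k) x| <= n%:R * K * I f.
Proof.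
move=> fi sf kn; apply: le_trans (ler_norm_sum _ _ _) _.
rewrite -mulrA mulr_natl -[in leRHS](card_ord n) -sumr_const; apply: ler_sum => i _.
rewrite normrM mulrC; apply: ler_pM => //.
  rewrite /pullback /window; case: ifPn => [xab|_]; first by rewrite EK ?itv01.
  rewrite normr0; apply: le_trans (@EK 0 0 0 n0 isT _); first exact: normr_ge0.
  by rewrite lexx ler01.
by have [_ _] := iterJP fi sf (n - i.+1); rewrite subnSK.
Qed.

Lemma corrector_bound f k x : L1 f -> supp f -> (k < n)%N ->
  `|corrector f k x| <= (1 + n%:R * K) * I f.
Proof.
move=> fi sf kn; rewrite mulrDl mul1r; apply: le_trans (ler_normB _ _) _.
apply: lerD; last exact: sum_bound (ltnW kn).
by have [_ _] := iterJP fi sf (n - k.+1); rewrite subnSK.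
Qed.

(** At order [n] the iterated primitive is [d * f], possibly unbounded; what remains is a bounded
    combination of polynomials. *)
Lemma corrector_top f x : L1 f -> supp f ->
  `|corrector f n x - d * f x| <= n%:R * K * I f.
Proof.
move=> fi sf; rewrite /corrector subnn/= addrAC subrr sub0r normrN.
exact: sum_bound.
Qed.

End Corrector.

(** * Solving the perturbed equation *)

Section FixedPoint.
Context {R : realType}.
Set Implicit Arguments.
Unset Strict Implicit.

Lemma expr2_small (C e : R) : 0 <= C -> 0 < e -> exists m : nat, C / 2 ^+ m < e.
Proof.
move=> C0 e0; exists (Num.bound (C / e)).
rewrite ltr_pdivrMr ?exprn_gt0// mulrC -ltr_pdivrMr//.
apply: lt_trans (archi_boundP _) _; first by rewrite divr_ge0// ltW.
by rewrite -natrX ltr_nat ltn_expl.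
Qed.

Variables (X : Type) (S : (X -> R) -> Prop) (T : (X -> R) -> X -> R) (B : R).
Hypothesis S0 : S (fun=> 0).
Hypothesis Slim : forall (w : nat -> X -> R) (u : X -> R), (forall m, S (w m)) ->
  (forall x, w m x @[m --> \oo] --> u x) -> (forall x, `|u x| <= 2 * B) -> S u.
Hypothesis ST : forall u, S u -> S (T u).
Hypothesis T0 : forall x, `|T (fun=> 0) x| <= B.
Hypothesis Thalf : forall u v c, S u -> S v -> 0 <= c ->
  (forall x, `|u x - v x| <= c) -> forall x, `|T u x - T v x| <= c / 2.

(** Picard iteration from 0 in the sup norm, with contraction factor [1 / 2]. The class [S] need
    only be stable under bounded pointwise limits, which suits measurability. *)
Lemma contraction_fixpoint : exists u, [/\ S u, forall x, T u x = u x &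
  forall x, `|u x| <= 2 * B].
Proof.
(* A point of [X] is what yields [0 <= B]; the empty case is vacuous. *)
have [/inhabited_witness x0|X0] := pselect (inhabited X); last first.
  have Xf (x : X) : False by apply: X0.
  by exists (fun=> 0); split=> // x; case: (Xf x).
have B0 : 0 <= B := le_trans (normr_ge0 _) (T0 x0).
pose w m := iter m T (fun=> 0).
have Sw m : S (w m) by elim: m => // m; exact: ST.
have w1 m x : `|w m.+1 x - w m x| <= B / 2 ^+ m.
  elim: m x => [|m ih] x; first by rewrite expr0 divr1 subr0; exact: T0.
  apply: le_trans (Thalf (Sw _) (Sw _) _ ih x) _; first by rewrite divr_ge0.
  by rewrite exprSr invfM mulrA.
(* The tail from [m] on of the geometric series with terms [B / 2 ^+ k]. *)
pose q m : R := 2 * B / 2 ^+ m.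
have qS m : q m - q m.+1 = B / 2 ^+ m.
  by rewrite /q exprSr; field; rewrite expf_neq0.
have q0 m : 0 <= q m by rewrite divr_ge0 ?mulr_ge0.
have wk m k x : `|w (k + m)%N x - w m x| <= q m - q (k + m)%N.
  elim: k => [|k ih]; first by rewrite !subrr normr0.
  rewrite (_ : _ - _ = (w (k + m).+1 x - w (k + m)%N x) + (w (k + m)%N x - w m x)); last by ring.
  apply: le_trans (ler_normD _ _) _; have := w1 (k + m)%N x; rewrite -qS; lra.
have wq m x : `|w m x| <= 2 * B.
  have := wk 0 m x; rewrite addn0 /q expr0 divr1 subr0 => /le_trans; apply.
  by rewrite gerBl q0.
(* A step of [w] goes down by at most the decrease of [q]. So [w - q] is monotone and bounded, and
   [w] converges pointwise. *)
have wmono x : nondecreasing_seq (fun m => w m x - q m).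
  apply/nondecreasing_seqP => m; have := w1 m x; rewrite -qS ler_norml => /andP[+ _]; lra.
have qcvg : q @ \oo --> 0.
  apply/cvgrPdist_lt => e e0; have [m me] := @expr2_small (2 * B) e (mulr_ge0 (ler0n _ _) B0) e0.
  exists m => // k /= mk; rewrite sub0r normrN ger0_norm// (le_lt_trans _ me)//.
  by rewrite ler_wpM2l ?mulr_ge0// lef_pV2 ?posrE ?exprn_gt0// ler_weXn2l// ler1n.
have wcvg x : cvgn (fun m => w m x).
  rewrite (_ : (fun m => _) = (fun m => (w m x - q m) + q m)); last first.
    by apply/funext => m; rewrite subrK.
  apply: is_cvgD; last by apply/cvg_ex; exists 0.
  apply: nondecreasing_is_cvgn; first exact: wmono.
  exists (2 * B) => _ [m _ <-]; have := wq m x; rewrite ler_norml => /andP[_].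
  have := q0 m; lra.
pose u x := limn (fun m => w m x).
have wu x : w m x @[m --> \oo] --> u x by exact: wcvg.
have uw m x : `|u x - w m x| <= q m.
  apply/ler_addgt0Pl => e e0.
  have /cvgrPdist_lt/(_ _ e0)[k _ hk] := wu x.
  have := hk (k + m)%N (leq_addr _ _); have := wk m k x; have := q0 (k + m)%N.
  move=> qkm h1 /= h2.
  rewrite (_ : _ - _ = (u x - w (k + m)%N x) + (w (k + m)%N x - w m x)); last by ring.
  by apply: le_trans (ler_normD _ _) _; lra.
have u2B x : `|u x| <= 2 * B.
  by have := uw 0%N x; rewrite subr0 /q expr0 divr1.
have Su : S u by apply: Slim Sw wu u2B.
exists u; split=> // x; apply/eqP; rewrite -subr_eq0 -normr_le0.
apply/ler_addgt0Pl => e e0; rewrite addr0.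
have [m me] := @expr2_small (2 * B) e (mulr_ge0 (ler0n _ _) B0) e0.
(* Both differences are at most [q m / 2], the first by contraction and the second by [uw] at
   [m.+1]. *)
rewrite (_ : _ - _ = (T u x - T (w m) x) - (u x - w m.+1 x)); last by rewrite /w/=; ring.
apply: le_trans (ler_normB _ _) _; apply: le_trans (ltW me); rewrite -/(q m).
have := Thalf Su (Sw m) (q0 m) (uw m) x; have := uw m.+1 x.
have -> : q m.+1 = q m / 2 by rewrite /q exprSr invfM mulrA.
lra.
Qed.

End FixedPoint.

(** * The real system for the scaled derivatives on one interval *)

Section RealSystem.
Context {R : realType}.
Set Implicit Arguments.
Unset Strict Implicit.
Notation mu := (@lebesgue_measure R).
Notation I f := (\int[mu]_t `|f t|).

Lemma L1M (f u : R -> R) M : L1 f -> measurable_fun setT u ->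
  (forall x, `|u x| <= M) -> L1 (fun x => f x * u x).
Proof.
move=> fi mu_ uM; have bu : [bounded u x | x in setT].
  by exists M; split; [rewrite num_real|move=> x Mx y _ /=; rewrite (le_trans (uM y))// ltW].
by apply: eq_integrable (integrableMl _ fi mu_ bu).
Qed.

Lemma int_le (f g : R -> R) : L1 f -> L1 g -> (forall x, f x <= g x) ->
  \int[mu]_t f t <= \int[mu]_t g t.
Proof. by move=> fi gi fg; apply: le_Rintegral => // x _; exact: fg. Qed.

(* Component [beta] of the product of the complex numbers with components [p] and [u];
   [false] stands for the real part and [true] for the imaginary part. *)
Definition cmul_part (p u : bool -> R) (beta : bool) : R :=
  p false * u beta + (if beta then 1 else -1) * (p true * u (~~ beta)).

Lemma cmul_part_le p u beta M : (forall c, `|u c| <= M) ->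
  `|cmul_part p u beta| <= (`|p false| + `|p true|) * M.
Proof.
move=> uM; apply: le_trans (ler_normD _ _) _; rewrite mulrDl; apply: lerD.
  by rewrite normrM ler_wpM2l.
rewrite !normrM (_ : `|(if beta then 1 else -1) : R| = 1) ?mul1r ?ler_wpM2l//.
by case: beta; rewrite ?normrN normr1.
Qed.

Lemma cmul_partB p u v beta : cmul_part p (fun c => u c - v c) beta =
  cmul_part p u beta - cmul_part p v beta.
Proof. by rewrite /cmul_part; ring. Qed.

Section Interval.
Variables (a b : R).
Hypothesis ab : a < b.
Hypothesis ab1 : b - a <= 1.
Let d := b - a.
Let d0 : 0 < d. Proof. by rewrite subr_gt0. Qed.
Variables (n : nat) (p : nat -> bool -> R -> R).
Hypothesis n0 : (0 < n)%N.
Hypothesis pL1 : forall j c, (1 <= j <= n)%N -> L1 (p j c).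
Hypothesis ps : forall j c, (1 <= j <= n)%N -> supp a b (p j c).

Implicit Types (u v : bool -> nat -> R -> R) (M : R).

Let Q (x : R) : R := \sum_(1 <= j < n.+1) (`|p j false x| + `|p j true x|).

(** If [u c k] are the parts of [d ^+ k] times the [k]-th derivative of [y], this is [d ^+ n.-1]
    times minus the lower-order terms of [l(y)], because [d ^+ n.-1 = d ^+ j.-1 * d ^+ (n - j)]. *)
Definition forcing (u : bool -> nat -> R -> R) (beta : bool) (x : R) : R :=
  - \sum_(1 <= j < n.+1) d ^+ j.-1 *
      cmul_part (fun c => p j c x) (fun c => u c (n - j)%N x) beta.

(** Since [d <= 1], the powers of [d] only help, and the estimate is uniform in the length of the
    interval. *)
Lemma forcing_le u beta M x : (forall c k x, (k < n)%N -> `|u c k x| <= M) ->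
  `|forcing u beta x| <= Q x * M.
Proof.
move=> uM; rewrite normrN; apply: le_trans (ler_norm_sum _ _ _) _.
rewrite mulr_suml !big_nat; apply: ler_sum => j /andP[j1 jn].
rewrite normrM -[leRHS]mul1r; apply: ler_pM => //.
  by rewrite ger0_norm ?exprn_ge0 ?exprn_ile1// ltW.
by apply: cmul_part_le => c; apply: uM; lia.
Qed.

Lemma forcingB u v beta x :
  forcing (fun c k x => u c k x - v c k x) beta x = forcing u beta x - forcing v beta x.
Proof.
rewrite /forcing -[RHS]opprD -sumrB; congr (- _).
by apply: eq_bigr => j _; rewrite cmul_partB mulrBr.
Qed.

Lemma forcing_L1 u beta M : (forall c k, (k < n)%N -> measurable_fun setT (u c k)) ->
  (forall c k x, (k < n)%N -> `|u c k x| <= M) -> L1 (forcing u beta).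
Proof.
move=> um uM.
have h : L1 (fun x => - 1 * \sum_(1 <= j < n.+1) d ^+ j.-1 *
      cmul_part (fun c => p j c x) (fun c => u c (n - j)%N x) beta).
  apply: L1Z; apply: L1_sum => j; rewrite mem_index_iota => /andP[j1 jn].
  have jn' : (n - j < n)%N by lia.
  have j1n : (1 <= j <= n)%N by rewrite j1.
  apply: L1Z; apply: L1D; first exact: L1M (pL1 _ j1n) (um _ _ jn') (fun x => uM _ _ _ jn').
  by apply: L1Z; exact: L1M (pL1 _ j1n) (um _ _ jn') (fun x => uM _ _ _ jn').
by apply: eq_integrable h => // x _ /=; rewrite /forcing mulN1r.
Qed.

Lemma forcing_supp u beta : supp a b (forcing u beta).
Proof.
move=> x xab; rewrite /forcing big_nat big1 ?oppr0// => j jn.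
by rewrite /cmul_part !ps// !mul0r mulr0 addr0 mulr0.
Qed.

Lemma Q_L1 : L1 Q.
Proof.
apply: L1_sum => j; rewrite mem_index_iota => /andP[j1 jn].
have j1n : (1 <= j <= n)%N by rewrite j1.
by apply: L1D; apply: L1_abs; exact: pL1.
Qed.

Lemma forcing_int u beta M : (forall c k, (k < n)%N -> measurable_fun setT (u c k)) ->
  (forall c k x, (k < n)%N -> `|u c k x| <= M) -> I (forcing u beta) <= M * \int[mu]_t Q t.
Proof.
move=> um uM; rewrite -RintegralZl//; last exact: Q_L1.
apply: int_le.
- by apply: L1_abs; exact: forcing_L1 um uM.
- by apply: L1Z; exact: Q_L1.
- by move=> x; rewrite mulrC forcing_le.
Qed.

Variables (E : nat -> {poly R}) (Y : {poly R}) (K B c eta : R).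
Hypothesis EP : forall i k, (i < n)%N -> (k < n)%N ->
  ((E i)^`(k)).[0] = 0 /\ ((E i)^`(k)).[1] = (i == k)%:R.
Hypothesis EK : forall i k s, (i < n)%N -> (k <= n)%N -> 0 <= s <= 1 ->
  `|((E i)^`(k)).[s]| <= K.
Hypothesis YP : forall k, (k < n)%N -> (Y^`(k)).[0] = 0 /\ (Y^`(k)).[1] = 0.
Hypothesis YB : forall k s, (k <= n)%N -> 0 <= s <= 1 -> `|(Y^`(k)).[s]| <= B.
Hypothesis Yc : forall s, 1 / 4 <= s <= 3 / 4 -> c <= Y.[s].
Hypothesis K0 : 0 <= K.
Hypothesis B0 : 0 <= B.
Hypothesis eta_half : (1 + n%:R * K) * eta <= 1 / 2.
Hypothesis eta_c : (1 + n%:R * K) * (2 * B * eta) <= c / 2.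
Hypothesis Qeta : \int[mu]_t Q t <= eta.

Let K1 : 0 <= 1 + n%:R * K. Proof. by rewrite addr_ge0// mulr_ge0. Qed.

Let base (beta : bool) k x : R := if beta then 0 else pullback a b Y^`(k) x.

(** One Picard step: the real bump plus the corrected solution of the equation whose right-hand side
    is computed from [u]. *)
Let fam u beta k x := base beta k x + corrector a b n E (forcing u beta) k x.

Let base_bound beta k x : (k <= n)%N -> `|base beta k x| <= B.
Proof.
rewrite /base => kn; case: beta; first by rewrite normr0.
rewrite /pullback /window; have [xab|_] := boolP (a <= x <= b); last by rewrite normr0.
by rewrite YB// itv01.
Qed.

Let base_L1 beta k : L1 (base beta k).
Proof.
case: beta; last exact: pullback_L1.
by apply: eq_integrable (integrable0 _ _).
Qed.

Let base_supp beta k : supp a b (base beta k).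
Proof. by case: beta => // x xab; rewrite /base /pullback window_supp. Qed.

Let base_chain beta k x : (k < n)%N -> base beta k x = J (base beta k.+1) x / d.
Proof.
move=> kn; rewrite /base; case: beta.
  by rewrite /J Rintegral_eq0 ?mul0r.
by rewrite derivnS; apply: pullback_chain => //; case: (YP kn).
Qed.

(* [F beta k] is component [beta] of [d^k y^(k)], where [y] is the sought function, and
   [G] is then component [beta] of [d^n l(y)]. *)
Theorem system_solution : exists F : bool -> nat -> R -> R,
  [/\ forall beta k, L1 (F beta k) /\ supp a b (F beta k),
      forall beta k x, (k < n)%N -> F beta k x = J (F beta k.+1) x / d,
      forall beta x, `|F beta 0%N x| <= 2 * B,
      forall x, 1 / 4 <= (x - a) / d <= 3 / 4 -> c / 2 <= F false 0%N x &
      forall beta, let G x := F beta n x + \sum_(1 <= j < n.+1) d ^+ j *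
         cmul_part (fun c => p j c x) (fun c => F c (n - j)%N x) beta in
       L1 G /\ forall x, `|G x| <= 2 * B].
Proof.
(* The whole family is packed into one real function of a triple, so that a single sup norm controls
   all parts and orders. Only orders below [n] are iterated; [T] puts 0 elsewhere. *)
pose cur (u : bool * nat * R -> R) beta k x := u (beta, k, x).
pose T (u : bool * nat * R -> R) (z : bool * nat * R) :=
  if (z.1.2 < n)%N then fam (cur u) z.1.1 z.1.2 z.2 else 0.
pose S (u : bool * nat * R -> R) :=
  (forall beta k, (k < n)%N -> measurable_fun setT (cur u beta k)) /\
  exists M, forall z, `|u z| <= M.
have SF (u : bool * nat * R -> R) : S u -> forall beta, L1 (forcing (cur u) beta).
  by move=> [um [M uM]] beta; apply: forcing_L1 um (fun c k x _ => uM _).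
have [u [Su Tu uB]] : exists u : bool * nat * R -> R,
    [/\ S u, forall z, T u z = u z & forall z, `|u z| <= 2 * B].
  apply: contraction_fixpoint.
  - by split=> [beta k _|]; [exact: measurable_cst|exists 0 => z; rewrite normr0].
  - move=> w u Sw wu u2B; split=> [beta k kn|]; last by exists (2 * B).
    apply: (measurable_fun_cvg (h := fun m => cur (w m) beta k)).
    + by move=> m; have [h _] := Sw m; exact: h.
    + by move=> x _; exact: wu.
  - move=> u Su; have [um [M uM]] := Su; split=> [beta k kn|].
      rewrite /cur /T/= kn; apply: measurable_funD; apply: L1_meas => //.
      by apply: corrector_L1 => //; [exact: SF|exact: forcing_supp].
    exists (B + (1 + n%:R * K) * (M * \int[mu]_t Q t)) => -[[beta k] x]; rewrite /T/=.
    have M0 : 0 <= M := le_trans (normr_ge0 _) (uM (false, 0%N, 0)).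
    have Q0 : 0 <= \int[mu]_t Q t.
      by apply: Rintegral_ge0 => t _; apply: sumr_ge0 => j _; exact: addr_ge0.
    case: ifP => kn; last by rewrite normr0 addr_ge0// mulr_ge0// mulr_ge0.
    apply: le_trans (ler_normD _ _) _; apply: lerD; first exact: base_bound (ltnW kn).
    apply: le_trans (corrector_bound ab n0 EK _ (SF _ Su _) (forcing_supp _ _) kn) _.
    by apply: ler_wpM2l => //; exact: forcing_int um (fun _ _ _ _ => uM _).
  - move=> [[beta k] x]; rewrite /T/=; case: ifP => kn; last by rewrite normr0.
    (* Zero produces no forcing, so [T] sends it to the bump, which is bounded by [B]. *)
    have z0 : forcing (cur (fun=> 0)) beta = fun=> 0.
      apply/funext => t; rewrite /forcing big1 ?oppr0// => j _.
      by rewrite /cur /cmul_part !mulr0 addr0 mulr0.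
    have L0 : L1 (forcing (cur (fun=> 0)) beta).
      by rewrite z0; apply: eq_integrable (integrable0 _ _).
    apply: le_trans (ler_normD _ _) _; rewrite -[leRHS]addr0.
    apply: lerD; first exact: base_bound (ltnW kn).
    apply: le_trans (corrector_bound ab n0 EK _ L0 (forcing_supp _ _) kn) _.
    by rewrite z0 Rintegral_eq0 ?mulr0// => t _; rewrite normr0.
  - move=> u v M Su Sv M0 uvM [[beta k] x]; rewrite /T/=; case: ifP => kn; last first.
      by rewrite subrr normr0 divr_ge0.
    (* The bumps cancel, so the difference is the corrector of the forcing of [u - v], and
       [eta_half] gives the factor [1 / 2]. *)
    have Fuv : (fun t => forcing (cur u) beta t - forcing (cur v) beta t) =
        forcing (cur (fun z => u z - v z)) beta.
      by apply/funext => t; rewrite /cur forcingB.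
    have muv c' k' : (k' < n)%N -> measurable_fun setT (cur (fun z => u z - v z) c' k').
      by move=> k'n; apply: measurable_funB; [exact: Su.1|exact: Sv.1].
    rewrite /fam opprD addrACA subrr add0r -correctorB//; first last.
    + exact: forcing_supp.
    + exact: SF.
    + exact: forcing_supp.
    + exact: SF.
    rewrite Fuv.
    have Luv : L1 (forcing (cur (fun z => u z - v z)) beta).
      by apply: forcing_L1 muv (fun c k x _ => uvM _).
    apply: le_trans (corrector_bound ab n0 EK _ Luv (forcing_supp _ _) kn) _.
    apply: le_trans (ler_wpM2l K1 (forcing_int _ muv (fun c k x _ => uvM _))) _.
    rewrite mulrCA ler_wpM2l// -div1r; apply: le_trans eta_half.
    by rewrite ler_wpM2l.
have [um _] := Su.
have uB' c' k x : (k < n)%N -> `|cur u c' k x| <= 2 * B by move=> _; exact: uB.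
have FL beta := SF _ Su beta.
have Fs beta := forcing_supp (cur u) beta.
have IF beta : I (forcing (cur u) beta) <= 2 * B * eta.
  apply: le_trans (forcing_int _ um uB') _; rewrite ler_wpM2l// mulr_ge0//.
have uE beta k x : (k < n)%N -> cur u beta k x = fam (cur u) beta k x.
  by move=> kn; rewrite /cur -Tu /T/= kn.
(* The witness is [fam (cur u)], which agrees with the fixed point below order [n] and also supplies
   the derivative of order [n]. *)
exists (fam (cur u)); split.
- move=> beta k; split; first by apply: L1D => //; exact: corrector_L1.
  by move=> x xab; rewrite /fam base_supp// corrector_supp// addr0.
- move=> beta k x kn; rewrite {1}/fam base_chain// corrector_chain// -mulrDl -JD//.
  exact: corrector_L1.
- by move=> beta x; rewrite -uE// uB.
(* In the middle half the bump is at least [c], and by [eta_c] the correction is at most [c / 2]. *)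
- move=> x xm.
  have xab : a <= x <= b.
    move: xm => /andP[x1 x2]; have : 0 <= (x - a) / d by apply: le_trans x1.
    have : (x - a) / d <= 1 by apply: le_trans x2 _; lra.
    by rewrite ler_pdivrMr// mul1r pmulr_lge0 ?invr_gt0// subr_ge0 lerD2r => -> ->.
  have := corrector_bound ab n0 EK x (FL false) (Fs false) n0.
  move=> /le_trans/(_ (ler_wpM2l K1 (IF false)))/le_trans/(_ eta_c).
  rewrite /fam /base /pullback /window xab ler_norml => /andP[+ _].
  have := Yc xm; rewrite /=; lra.
- move=> beta G.
  (* The lower-order terms are exactly [- d * forcing], which cancels the possibly unbounded part of
     the top derivative. The bump and the polynomial remainder are then bounded by [B] each. *)
  have GE : G = fun x => base beta n x +
      (corrector a b n E (forcing (cur u) beta) n x - d * forcing (cur u) beta x).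
    apply/funext => x; rewrite /G /fam -addrA; congr (_ + (_ + _)).
    rewrite /forcing mulrN opprK mulr_sumr !big_nat; apply: eq_bigr => j /andP[j1 jn].
    rewrite mulrA -exprS prednK//; congr (_ * cmul_part _ _ _).
    by apply/funext => c'; rewrite uE//; lia.
  have Glast : L1 (corrector a b n E (forcing (cur u) beta) n) by exact: corrector_L1.
  rewrite GE; split.
    by apply: L1D => //; apply: L1B => //; exact: L1Z.
  move=> x; apply: le_trans (ler_normD _ _) _; rewrite [2 * B]mulrDl mul1r.
  apply: lerD; first exact: base_bound.
  apply: le_trans (corrector_top ab n0 EK _ (FL _) (Fs _)) _.
  apply: (@le_trans _ _ ((1 + n%:R * K) * (2 * B * eta))).
    apply: ler_pM => //; first by rewrite mulr_ge0.
    - exact: Rintegral_ge0.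
    - by rewrite lerDr.
  have -> : (1 + n%:R * K) * (2 * B * eta) = 2 * B * ((1 + n%:R * K) * eta) by ring.
  apply: le_trans (ler_wpM2l _ eta_half) _; first by rewrite mulr_ge0.
  by rewrite mulrAC [2 * _]mulrC; lra.
Qed.

End Interval.
End RealSystem.

(** * Complex test functions *)

Section ComplexPart.
Context {R : realType}.
Set Implicit Arguments.
Unset Strict Implicit.
Notation mu := (@lebesgue_measure R).
Implicit Types (z w : R[i]) (f g : R -> R[i]).

(** A boolean index lets one real statement serve both the real and the imaginary part. *)
Definition part (beta : bool) z : R := if beta then complex.Im z else complex.Re z.

Lemma partD beta z w : part beta (z + w) = part beta z + part beta w.
Proof. by case: z; case: w; case: beta. Qed.

Lemma partN beta z : part beta (- z) = - part beta z.
Proof. by case: z; case: beta. Qed.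

Lemma part0 beta : part beta 0 = 0. Proof. by case: beta. Qed.

Lemma part_sum (T : Type) (s : seq T) (F : T -> R[i]) beta :
  part beta (\sum_(i <- s) F i) = \sum_(i <- s) part beta (F i).
Proof. by apply: (big_morph (part beta)); [exact: partD|exact: part0]. Qed.

Lemma partM beta z w :
  part beta (z * w) = cmul_part (part^~ z) (part^~ w) beta.
Proof.
by case: z; case: w => c d a b; case: beta; rewrite /cmul_part/=; ring.
Qed.

Lemma cmod2 z : cmod z ^+ 2 = part false z ^+ 2 + part true z ^+ 2.
Proof. by rewrite /cmod sqr_sqrtr// addr_ge0 ?sqr_ge0. Qed.

Lemma cmod_ge0 z : 0 <= cmod z. Proof. exact: sqrtr_ge0. Qed.

Lemma part_le_cmod beta z : `|part beta z| <= cmod z.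
Proof.
rewrite -(@ler_pXn2r _ 2)// ?nnegrE ?cmod_ge0// cmod2 real_normK ?num_real//.
by case: beta; rewrite ?lerDl ?lerDr sqr_ge0.
Qed.

Lemma cmod_le_parts z : cmod z <= `|part false z| + `|part true z|.
Proof.
rewrite -(@ler_pXn2r _ 2)// ?nnegrE ?cmod_ge0 ?addr_ge0// cmod2 sqrrD.
rewrite !real_normK ?num_real// -addrA [_ *+ 2 + _]addrC addrA lerDl mulrn_wge0//.
Qed.

Definition bddsupp (a b M : R) f := forall beta,
  [/\ measurable_fun setT (fun x => part beta (f x)),
      supp a b (fun x => part beta (f x)) & forall x, `|part beta (f x)| <= M].

Lemma cmeasurable_setT f : (forall beta, measurable_fun setT (fun x => part beta (f x))) ->
  cmeasurable (Rplus (R := R)) f.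
Proof.
by move=> fm; split; apply: measurable_funTS; [exact: (fm false)|exact: (fm true)].
Qed.

Lemma bddsupp_L2 a b M f : a < b -> bddsupp a b M f ->
  L2 f /\ (l2sq f <= (2 * M ^+ 2 * (b - a))%:E)%E.
Proof.
move=> ab fM.
pose g x := part false (f x) ^+ 2 + part true (f x) ^+ 2.
have gm : measurable_fun setT g.
  apply: measurable_funD; apply: measurable_funX.
  - by have [] := fM false.
  - by have [] := fM true.
have g0 x : 0 <= g x by rewrite addr_ge0// sqr_ge0.
have gs : supp a b g.
  move=> x xab; rewrite /g; have [_ -> // _] := fM false; have [_ -> // _] := fM true.
  by rewrite expr0n/= addr0.
have gM x : a <= x <= b -> `|g x| <= 2 * M ^+ 2.
  move=> _; rewrite ger0_norm// mulrDl mul1r /g; apply: lerD.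
  - have [_ _ h] := fM false; rewrite -real_normK ?num_real//.
    by rewrite lerXn2r ?nnegrE ?(le_trans (normr_ge0 _) (h x)).
  - have [_ _ h] := fM true; rewrite -real_normK ?num_real//.
    by rewrite lerXn2r ?nnegrE ?(le_trans (normr_ge0 _) (h x)).
have [gi gle] := L1_bounded ab gm gs gM.
have le1 : (l2sq f <= (2 * M ^+ 2 * (b - a))%:E)%E.
  apply: (@le_trans _ _ (\int[mu]_x (g x)%:E)%E).
    rewrite /l2sq; under eq_integral do rewrite cmod2.
    apply: ge0_subset_integral => //.
    - exact: measurable_itv.
    - by apply/measurable_EFinP; exact: gm.
    - by move=> x _; rewrite lee_fin; exact: g0.
  rewrite -(@fineK _ (\int[mu]_x _)%E); last exact: (integrable_fin_num _ gi).
  rewrite lee_fin; apply: le_trans gle; rewrite le_eqVlt; apply/orP; left; apply/eqP.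
  by apply: eq_Rintegral => x _; rewrite ger0_norm.
split=> //; split; last exact: le_lt_trans le1 (ltry _).
by apply: cmeasurable_setT => beta; have [] := fM beta.
Qed.

(** Applied to [l(y)] and [y], this bounds the function [l(y) - lam y], which the resolvent sends to
    [y]. *)
Lemma bddsupp_sub a b M (lam : R[i]) f g : bddsupp a b M f -> bddsupp a b M g ->
  bddsupp a b (M + (`|part false lam| + `|part true lam|) * M) (fun x => f x - lam * g x).
Proof.
move=> fM gM beta; have [fm fs fb] := fM beta.
have E x : part beta (f x - lam * g x) =
    part beta (f x) - cmul_part (part^~ lam) (part^~ (g x)) beta.
  by rewrite partD partN partM.
split.
- under eq_fun do rewrite E; apply: measurable_funB => //.
  apply: measurable_funD; apply: measurable_funM; try exact: measurable_cst.
    by have [] := gM beta.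
  by apply: measurable_funM; [exact: measurable_cst|have [] := gM (~~ beta)].
- move=> x xab; rewrite E fs// /cmul_part.
  by have [_ -> // _] := gM beta; have [_ -> // _] := gM (~~ beta); rewrite !mulr0 addr0 subr0.
move=> x; rewrite E; apply: le_trans (ler_normB _ _) _; apply: lerD => //.
by apply: cmul_part_le => c; have [_ _] := gM c.
Qed.

Lemma ACloc_J f g : (forall beta, L1 (fun x => part beta (g x))) ->
  (forall beta x, part beta (f x) = J (fun t => part beta (g t)) x) -> ACloc f.
Proof.
move=> gi fJ B B0 e e0; have e2 : 0 < e / 2 by rewrite divr_gt0.
have [d1 d10 H1] := J_abs_cont (gi false) e2.
have [d2 d20 H2] := J_abs_cont (gi true) e2.
exists (Num.min d1 d2); first by rewrite lt_min d10.
move=> k u v uv vu; rewrite lt_min => /andP[s1 s2].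
have uv' i : (i < k)%N -> u i <= v i by move=> /uv[_ []].
have h1 := H1 k u v uv' vu s1; have h2 := H2 k u v uv' vu s2.
rewrite [ltRHS](splitr e); apply: le_lt_trans (ltrD h1 h2).
rewrite -big_split; apply: ler_sum => i _ /=.
by apply: le_trans (cmod_le_parts _) _; rewrite !partD !partN !fJ.
Qed.

Lemma deriv_ae_J f g : (forall beta, L1 (fun x => part beta (g x))) ->
  (forall beta x, part beta (f x) = J (fun t => part beta (g t)) x) -> deriv_ae f g.
Proof.
move=> gi fJ; have h1 := J_ae_derive (gi false); have h2 := J_ae_derive (gi true).
rewrite -(funext (fJ false)) in h1; rewrite -(funext (fJ true)) in h2.
have FF := ae_filter_ringOfSetsType mu.
by apply: (filterS2 FF _ h1 h2) => x dr di _; split.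
Qed.

End ComplexPart.

(** * Test functions on short intervals where the coefficients are small *)

Section TestFunction.
Context {R : realType}.
Set Implicit Arguments.
Unset Strict Implicit.
Notation mu := (@lebesgue_measure R).

(** The order of the quantifiers matters: [eta] and [c] depend on [n] only, and [M] also on [d], but
    neither on the coefficients nor on the position [a]. Hence one set of constants serves a whole
    sequence of intervals of equal length. *)
Lemma test_function (n : nat) : (0 < n)%N ->
  exists eta c : R, [/\ 0 < eta, 0 < c &
    forall d : R, 0 < d -> d <= 1 -> exists M : R,
    forall (p : nat -> R -> R[i]) (a : R), 0 <= a ->
    let P j beta := window a (a + d) (fun x => part beta (p j x)) in
    (forall j beta, (1 <= j <= n)%N -> L1 (P j beta)) ->
    \int[mu]_t (\sum_(1 <= j < n.+1) (`|P j false t| + `|P j true t|)) <= eta ->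
    exists ys, [/\ D0 n p (ys 0%N) ys,
      bddsupp a (a + d) M (ys 0%N), bddsupp a (a + d) M (lexpr n p ys) &
      forall x, a + d / 4 <= x <= a + 3 * d / 4 -> c <= cmod (ys 0%N x)]].
Proof.
move=> n0.
have [E EP] := @hermite_end R n.
have [K K0 EK] := derivn_bounded E n.
have [Y YP [c c0 Yc]] := @bump_poly R n.
have [B B0 YB'] := derivn_bounded (fun=> Y) n.
have YB k s (kn : (k <= n)%N) (hs : 0 <= s <= 1) : `|(Y^`(k)).[s]| <= B := YB' 0%N k s n0 kn hs.
have K1 : 0 < 1 + n%:R * K by rewrite ltr_wpDr// mulr_ge0.
(* The first bound makes the Picard map a contraction; the second keeps the correction below half
   the bump. [2 * B + 1] is used as a positive denominator. *)
pose eta := Num.min (1 / 2 / (1 + n%:R * K)) (c / 2 / (1 + n%:R * K) / (2 * B + 1)).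
have B1 : 0 < 2 * B + 1 by rewrite ltr_wpDl// mulr_ge0.
have eta0 : 0 < eta by rewrite lt_min !divr_gt0.
have eta1 : (1 + n%:R * K) * eta <= 1 / 2.
  by rewrite mulrC -ler_pdivlMr// ge_min lexx.
have eta2 : (1 + n%:R * K) * (2 * B * eta) <= c / 2.
  rewrite mulrC -ler_pdivlMr//; apply: (@le_trans _ _ (eta * (2 * B + 1))).
    by rewrite mulrC ler_pM2l// lerDl.
  by rewrite -ler_pdivlMr// ge_min lexx orbT.
exists eta, (c / 2); split; rewrite ?divr_gt0// => d d0 d1.
(* Undoing the scaling leaves [y] bounded by [2 * B] and [l(y)] by [2 * B / d ^+ n]; the sum covers
   both. *)
exists (2 * B * (1 + (d ^+ n)^-1)) => p a a0 P PL1 PI.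
have ab : a < a + d by rewrite ltrDl.
have abd : a + d - a = d by rewrite addrC addKr.
have ab1 : a + d - a <= 1 by rewrite abd.
have [F [FL Fchain FB Fc FG]] := @system_solution R a (a + d) ab ab1 n P n0 PL1
  (fun j beta _ => @window_supp _ _ _ _) E Y K B c eta EP EK YP YB Yc K0 B0 eta1 eta2 PI.
rewrite abd in Fchain Fc FG.
pose ys k x : R[i] := complex.Complex (d ^- k * F false k x) (d ^- k * F true k x).
have ysE beta k x : part beta (ys k x) = d ^- k * F beta k x by case: beta.
have ysL beta k : L1 (fun x => part beta (ys k x)).
  by under eq_fun do rewrite ysE; apply: L1Z; have [] := FL beta k.
have yss beta k : supp a (a + d) (fun x => part beta (ys k x)).
  by move=> x xab; rewrite ysE; have [_ ->//] := FL beta k; rewrite mulr0.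
have ysJ beta k x : (k < n)%N -> part beta (ys k x) = J (fun t => part beta (ys k.+1 t)) x.
  move=> kn; rewrite (_ : (fun t => _) = fun t => d ^- k.+1 * F beta k.+1 t); last first.
    by apply/funext => t; exact: ysE.
  rewrite JZ; last by have [] := FL beta k.+1.
  rewrite ysE Fchain// exprS invfM; ring.
have lE beta x : part beta (lexpr n p ys x) = d ^- n * (F beta n x + \sum_(1 <= j < n.+1) d ^+ j *
         cmul_part (fun c => P j c x) (fun c => F c (n - j)%N x) beta).
  rewrite /lexpr partD part_sum ysE mulrDr; congr (_ + _); rewrite mulr_sumr !big_nat.
  apply: eq_bigr => j /andP[j1 jn]; rewrite partM mulrA.
  have -> : d ^- n * d ^+ j = d ^- (n - j)%N.
    have {1}-> : n = (n - j + j)%N by rewrite subnK.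
    by rewrite exprD invfM -mulrA mulVf ?mulr1// expf_neq0// gt_eqF.
  rewrite /cmul_part !ysE /P /window; move: (d ^- (n - j)%N) => e.
  (* Outside the interval [P] and [p] may differ, but there every [F] vanishes. *)
  have [xab|xab] := boolP (a <= x <= a + d); first by ring.
  have [_ ->//] := FL beta (n - j)%N; have [_ ->//] := FL (~~ beta) (n - j)%N.
  by rewrite !mulr0 addr0 mulr0.
have bl : bddsupp a (a + d) (2 * B * (1 + (d ^+ n)^-1)) (lexpr n p ys).
  move=> beta; have [GL GB] := FG beta; split.
  - by under eq_fun do rewrite lE; apply: measurable_funM; [exact: measurable_cst|exact: L1_meas].
  - move=> x xab; rewrite lE; have [_ ->//] := FL beta n; rewrite add0r.
    rewrite big_nat big1 ?mulr0// => j _; rewrite /P /cmul_part !window_supp//.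
    by rewrite !mul0r mulr0 addr0 mulr0.
  - have dn : 0 <= d ^- n by rewrite invr_ge0 exprn_ge0// ltW.
    move=> x; rewrite lE normrM [ `|_ ^- _|]ger0_norm//.
    apply: (@le_trans _ _ (d ^- n * (2 * B))); first exact: ler_wpM2l.
    by rewrite mulrC ler_wpM2l ?mulr_ge0// lerDr.
have b0 : bddsupp a (a + d) (2 * B * (1 + (d ^+ n)^-1)) (ys 0%N).
  move=> beta; split; [exact: L1_meas|exact: yss|].
  move=> x; rewrite ysE expr0 invr1 mul1r mulrDr mulr1 ler_wpDr//.
  by apply: divr_ge0; [exact: mulr_ge0|rewrite exprn_ge0// ltW].
exists ys; split=> //.
  split=> //.
  - exact: (bddsupp_L2 ab b0).1.
  - move=> k kn; split; [apply: (@ACloc_J _ _ (ys k.+1))|apply: deriv_ae_J] => // beta x;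
      exact: ysJ.
  - exact: (bddsupp_L2 ab bl).1.
  - have zero x k : (forall beta, part beta (ys k x) = 0) -> ys k x = 0.
      by move=> h; have := h false; have := h true; case: (ys k x) => u v /= -> ->.
    split=> [k kn|].
      apply: zero => beta; rewrite ysJ//.
      (* Either 0 lies to the left of the support, or [a] is 0 and the primitive is an integral over
         one point. *)
      have [a_gt0|a_le0] := ltP 0 a; first by rewrite (J_lt_supp (yss _ _)).
      have a00 : a = 0 by apply/eqP; rewrite eq_le a_le0 a0.
      rewrite -[X in J _ X]a00 (J_supp (ysL _ _) (yss _ _))//.
      by rewrite set_itv1 Rintegral_set1.
    exists (a + d + 1); first by rewrite addr_gt0// ltr_wpDl.
    move=> x xb; apply: zero => beta; apply: yss; rewrite negb_and -!ltNge orbC.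
    by rewrite (lt_le_trans _ xb)// ltrDl.
move=> x /andP[x1 x2]; apply: le_trans (part_le_cmod false _).
apply: le_trans (ler_norm _); rewrite ysE expr0 invr1 mul1r; apply: Fc.
by rewrite ler_pdivlMr// ler_pdivrMr//; apply/andP; split; lra.
Qed.

End TestFunction.

(** * Intervals with small coefficients *)

Section Halving.
Context {R : realType}.
Set Implicit Arguments.
Unset Strict Implicit.
Notation mu := (@lebesgue_measure R).

(** Of the two halves of an interval, at least one carries at most half of the bound; this choice is
    repeated [r] times. *)
Lemma halving (q : R -> R) (u h A : R) : 0 < h ->
  mu.-integrable `[u, u + h] (EFin \o q) ->
  \int[mu]_(x in `[u, u + h]) q x <= A -> forall r : nat,
  exists v, [/\ u <= v, v + h / 2 ^+ r <= u + h &
    \int[mu]_(x in `[v, v + h / 2 ^+ r]) q x <= A / 2 ^+ r].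
Proof.
move=> h0 qi qA; elim=> [|r [v [uv vu vA]]].
  by exists u; rewrite expr0 !divr1; split.
pose e := h / 2 ^+ r.+1; have e0 : 0 < e by rewrite divr_gt0// exprn_gt0.
have e2 : h / 2 ^+ r = e + e by rewrite /e exprS; field; rewrite expf_neq0.
rewrite e2 in vu vA.
have qi' : mu.-integrable `[v, v + (e + e)] (EFin \o q).
  apply: integrableS qi; [exact: measurable_itv|exact: measurable_itv|].
  by apply: subset_itv; rewrite bnd_simp.
have := Rintegral_itvB (x := v + e) qi'.
rewrite !bnd_simp lerD2l !lerDl => /(_ (ltW e0) (ltW e0)).
rewrite Rintegral_itv_obnd_cbnd; last first.
  apply: integrableS qi'; [exact: measurable_itv|exact: measurable_itv|].
  by apply: subset_itv; rewrite bnd_simp// lerDl ltW.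
have A2 : A / 2 ^+ r = A / 2 ^+ r.+1 + A / 2 ^+ r.+1.
  by rewrite exprS; field; rewrite expf_neq0.
rewrite A2 in vA; rewrite -/e => split_eq.
have [le1|gt1] := leP (\int[mu]_(x in `[v, v + e]) q x) (A / 2 ^+ r.+1).
  by exists v; split=> //; lra.
exists (v + e); split; [lra|lra|].
by rewrite -addrA -split_eq; lra.
Qed.

Lemma Rintegral_windows (n : nat) (p : nat -> bool -> R -> R) (u v : R) : u < v ->
  (forall j beta, (1 <= j <= n)%N -> L1 (window u v (p j beta))) ->
  \int[mu]_t (\sum_(1 <= j < n.+1)
     (`|window u v (p j false) t| + `|window u v (p j true) t|)) =
  \int[mu]_(t in `[u, v]) (\sum_(1 <= j < n.+1) (`|p j false t| + `|p j true t|)).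
Proof.
move=> uv pL1; rewrite (@int_supp _ u v).
- apply: eq_Rintegral => t; rewrite inE/= in_itv/= => tuv.
  by under eq_bigr do rewrite /window tuv.
- apply: L1_sum => j; rewrite mem_index_iota => /andP[j1 jn].
  have j1n : (1 <= j <= n)%N by rewrite j1.
  by apply: L1D; apply: L1_abs; exact: pL1.
- by move=> t tuv; rewrite big1// => j _; rewrite !window_supp// normr0 addr0.
Qed.

Lemma L1loc_cmod_integrable (f : R -> R[i]) b : L1loc f -> 0 <= b ->
  mu.-integrable `[0, b] (EFin \o (fun x => cmod (f x))).
Proof.
move=> fL b0; have [[fr fi] foo] := fL _ b0; apply/integrableP; split.
  apply/measurable_EFinP; apply: (@measurableT_comp _ _ _ _ _ _ (@Num.sqrt R)).
    by apply: continuous_measurable_fun; exact: sqrt_continuous.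
  by apply: measurable_funD; apply: measurable_funX.
by under eq_integral do rewrite /= ger0_norm ?cmod_ge0//.
Qed.

Lemma L1loc_integrable (f : R -> R[i]) beta b : L1loc f -> 0 <= b ->
  mu.-integrable `[0, b] (EFin \o (fun x => part beta (f x))).
Proof.
move=> fL b0; have [[fr fi] _] := fL _ b0.
apply: (le_integrable _ _ _ (L1loc_cmod_integrable fL b0)) => //.
  by apply/measurable_EFinP; case: beta.
by move=> x _; rewrite /= lee_fin [leRHS]ger0_norm ?cmod_ge0// part_le_cmod.
Qed.

Lemma L1loc_window (f : R -> R[i]) beta u v : L1loc f -> 0 <= u -> u <= v ->
  L1 (window u v (fun x => part beta (f x))).
Proof.
move=> fL u0 uv; rewrite /L1 windowE -restrict_EFin.
apply/(integrable_mkcond _ _).1; first exact: measurable_itv.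
apply: integrableS (L1loc_integrable beta fL (le_trans u0 uv)).
- exact: measurable_itv.
- exact: measurable_itv.
- by apply: subset_itv; rewrite bnd_simp.
Qed.

Lemma L1loc_cst (C : R[i]) : L1loc (fun=> C).
Proof.
move=> b b0; split; first by split; exact: measurable_cst.
rewrite integral_cst; last exact: measurable_itv.
suff muE : mu `[0, b] = b%:E by move: muE => /= ->; rewrite -EFinM ltry.
rewrite lebesgue_measure_itv/= lte_fin; case: ltP => [_|b_le0]; first by rewrite sube0.
by congr EFin; apply/eqP; rewrite eq_le b0.
Qed.

End Halving.

(** * Separated sequences and compact resolvents *)

Section Separation.
Context {R : realType}.
Set Implicit Arguments.
Unset Strict Implicit.
Notation mu := (@lebesgue_measure R).
Implicit Types (f g h : R -> R[i]).

Let mRplus : measurable (Rplus (R := R)). Proof. exact: measurable_itv. Qed.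

Lemma cmeasurableB f g : cmeasurable (Rplus (R := R)) f -> cmeasurable (Rplus (R := R)) g ->
  cmeasurable (Rplus (R := R)) (fun x => f x - g x).
Proof.
move=> [fr fi] [gr gi]; split.
  rewrite (_ : (fun x => _) = fun x => complex.Re (f x) - complex.Re (g x)).
    exact: measurable_funB.
  by apply/funext => x; case: (f x) (g x) => [? ?] [? ?].
rewrite (_ : (fun x => _) = fun x => complex.Im (f x) - complex.Im (g x)).
  exact: measurable_funB.
by apply/funext => x; case: (f x) (g x) => [? ?] [? ?].
Qed.

Lemma measurable_cmod2 f : cmeasurable (Rplus (R := R)) f ->
  measurable_fun (Rplus (R := R)) (fun x => (cmod (f x) ^+ 2)%:E).
Proof.
move=> [fr fi]; apply/measurable_EFinP.
under eq_fun do rewrite cmod2.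
by apply: measurable_funD; apply: measurable_funX.
Qed.

Lemma cmod2_ge0 (z : R[i]) : (0 <= (cmod z ^+ 2)%:E)%E.
Proof. by rewrite lee_fin sqr_ge0. Qed.

(** A squared form of the triangle inequality, obtained pointwise from the parallelogram law: the
    two sides differ by the square of [f + g - 2 h]. *)
Lemma l2sq_sub_le f g h : cmeasurable (Rplus (R := R)) f ->
  cmeasurable (Rplus (R := R)) g -> cmeasurable (Rplus (R := R)) h ->
  (l2sq (fun x => f x - g x)%R <=
   2%:E * (l2sq (fun x => f x - h x)%R + l2sq (fun x => g x - h x)%R))%E.
Proof.
move=> fm gm hm.
have m1 := measurable_cmod2 (cmeasurableB fm hm).
have m2 := measurable_cmod2 (cmeasurableB gm hm).
have m12 : measurable_fun (Rplus (R := R))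
    (fun x => (cmod (f x - h x) ^+ 2)%:E + (cmod (g x - h x) ^+ 2)%:E)%E.
  exact: emeasurable_funD.
rewrite /l2sq -ge0_integralD//; try by move=> x _; exact: cmod2_ge0.
rewrite -ge0_integralZl//; last by move=> x _; rewrite adde_ge0 ?cmod2_ge0.
apply: ge0_le_integral => //.
- by move=> x _; exact: cmod2_ge0.
- exact: measurable_cmod2 (cmeasurableB fm gm).
- exact: measurable_funeM.
have sqr_le (f0 f1 g0 g1 h0 h1 : R) : (f0 - g0) ^+ 2 + (f1 - g1) ^+ 2 <=
    2 * ((f0 - h0) ^+ 2 + (f1 - h1) ^+ 2 + ((g0 - h0) ^+ 2 + (g1 - h1) ^+ 2)).
  rewrite -subr_ge0 (_ : _ - _ = (f0 + g0 - 2 * h0) ^+ 2 + (f1 + g1 - 2 * h1) ^+ 2).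
    by rewrite addr_ge0// sqr_ge0.
  by ring.
by move=> x _; rewrite -EFinD -EFinM lee_fin !cmod2 !partD !partN; exact: sqr_le.
Qed.

Lemma l2sq_ae f g : cmeasurable (Rplus (R := R)) f -> cmeasurable (Rplus (R := R)) g ->
  aeeq f g -> l2sq f = l2sq g.
Proof.
move=> fm gm fg; apply: ge0_ae_eq_integral => //.
- exact: measurable_cmod2.
- exact: measurable_cmod2.
- by move=> x _; exact: cmod2_ge0.
- by move=> x _; exact: cmod2_ge0.
have FF := ae_filter_ringOfSetsType mu.
by apply: filterS fg => x /= fgx Rx; rewrite fgx.
Qed.

(** Two terms at squared distance less than [e / 4] from the limit would be at squared distance less
    than [e] from each other. *)
Lemma separated_not_cvg (y : nat -> R -> R[i]) h (e : R) : 0 < e ->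
  (forall m, cmeasurable (Rplus (R := R)) (y m)) -> cmeasurable (Rplus (R := R)) h ->
  (forall i j, i != j -> (e%:E <= l2sq (fun x => y i x - y j x)%R)%E) ->
  ~ (l2sq (fun x => y m x - h x) @[m --> \oo] --> 0%E).
Proof.
move=> e0 ym hm sep /fine_cvgP[[N1 _ fin] /cvgrPdist_lt/(_ (e / 4))].
rewrite divr_gt0// => /(_ isT)[N2 _ small].
have le m : (N1 + N2 <= m)%N -> (l2sq (fun x => y m x - h x)%R < (e / 4)%:E)%E.
  move=> mN; have mN1 : (N1 <= m)%N by lia.
  have mN2 : (N2 <= m)%N by lia.
  rewrite -(fineK (fin _ mN1)) lte_fin.
  have := small _ mN2; rewrite /= sub0r normrN; exact/le_lt_trans/ler_norm.
pose i := (N1 + N2)%N.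
have := sep i i.+1; rewrite ltn_eqF// => /(_ isT).
apply/negP; rewrite -ltNge.
apply: le_lt_trans (l2sq_sub_le (ym _) (ym _) hm) _.
have -> : e%:E = (2%:E * ((e / 4)%:E + (e / 4)%:E))%E.
  by rewrite -EFinD -EFinM; congr EFin; field.
by rewrite lte_pmul2l// lteD// le.
Qed.

Lemma l2sq_lower f g (c s t : R) : 0 <= s -> s <= t -> 0 <= c ->
  cmeasurable (Rplus (R := R)) f -> cmeasurable (Rplus (R := R)) g ->
  (forall x, s <= x <= t -> c <= cmod (f x)) -> (forall x, s <= x <= t -> g x = 0) ->
  ((c ^+ 2 * (t - s))%:E <= l2sq (fun x => f x - g x)%R)%E.
Proof.
move=> s0 st c0 fm gm fc g0.
have sub : `[s, t] `<=` Rplus (R := R).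
  by apply: subset_itv; rewrite bnd_simp.
have m1 := measurable_cmod2 (cmeasurableB fm gm).
apply: (@le_trans _ _ (\int[mu]_(x in `[s, t]) (cmod (f x - g x) ^+ 2)%:E)%E); last first.
  apply: ge0_subset_integral => //.
  by move=> x _; exact: cmod2_ge0.
apply: (@le_trans _ _ (\int[mu]_(x in `[s, t]) (c ^+ 2)%:E)%E).
  rewrite integral_cst; last exact: measurable_itv.
  suff muE : mu `[s, t] = (t - s)%:E by move: muE => /= ->; rewrite -EFinM.
  rewrite lebesgue_measure_itv/= lte_fin; case: ltP => // ts.
  by rewrite (_ : t = s) ?subrr//; apply/eqP; rewrite eq_le ts.
apply: ge0_le_integral.
- exact: measurable_itv.
- by move=> x _; rewrite lee_fin sqr_ge0.
- exact: measurable_cst.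
- exact: measurable_funS sub m1.
- move=> x /=; rewrite in_itv/= => xst; rewrite lee_fin g0// subr0.
  by rewrite lerXn2r ?nnegrE ?cmod_ge0// fc.
Qed.

(** The [ys m] are images under the resolvent of a bounded sequence, so a subsequence would converge
    although all terms stay apart. The bound is required for every [lam] because the extension
    dictates which one occurs. *)
Lemma compact_resolvent_not_separated (n : nat) (p : nat -> R -> R[i])
    (G : set ((R -> R[i]) * (R -> R[i]))) (ys : nat -> nat -> R -> R[i]) (e : R) :
  is_operator G -> graphL0 n p `<=` G -> compact_resolvent G -> 0 < e ->
  (forall m, D0 n p (ys m 0%N) (ys m)) ->
  (forall lam : R[i], exists M : R, forall m,
     L2 (fun x => lexpr n p (ys m) x - lam * ys m 0%N x) /\
     (l2sq (fun x => lexpr n p (ys m) x - lam * ys m 0%N x)%R <= M%:E)%E) ->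
  (forall i j, i != j -> (e%:E <= l2sq (fun x => ys i 0%N x - ys j 0%N x)%R)%E) -> False.
Proof.
move=> [GL2 _ _ Glin _] LG [lam [Rl [RG inj cpt]]] e0 D0ys bdd sep.
have [M bM] := bdd lam.
pose g m := fun x => lexpr n p (ys m) x - lam * ys m 0%N x.
have gL2 m : L2 (g m) := (bM m).1.
have yL2 m : L2 (ys m 0%N) by have [] := D0ys m.
(* By linearity [y - Rl g] lies in the domain of the extension and is mapped to [lam] times itself,
   so injectivity makes it zero almost everywhere. *)
have Rae m : aeeq (fun x => ys m 0%N x + -1 * Rl (g m) x) (fun=> 0).
  apply: inj; have [_ GR] := RG _ (gL2 m).
  have Gy : G (ys m 0%N, lexpr n p (ys m)).
    apply: LG; exists (ys m 0%N), (ys m); split=> //=.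
    - by have [] := D0ys m.
    - exact: aeW.
    - exact: aeW.
  have := Glin _ _ _ _ (-1) Gy GR; congr (G (_, _)).
  by apply/funext => x; rewrite /g; ring.
have [phi [phiS [h [hm _] hcv]]] := cpt g gL2 (ex_intro _ M (fun m => (bM m).2)).
have phi_mono : {homo phi : i j / (i < j)%N}.
  by apply: homo_ltn => // a b c; exact: ltn_trans.
pose y m := ys (phi m) 0%N.
have ym m : cmeasurable (Rplus (R := R)) (y m) := (yL2 (phi m)).1.
apply: (separated_not_cvg e0 ym hm).
  move=> i j ij; apply: sep.
  by case: (ltngtP i j) ij => // [/phi_mono/ltn_eqF->|/phi_mono/gtn_eqF->].
rewrite (_ : (fun m => _) = (fun m => l2sq (fun x => Rl (g (phi m)) x - h x)))//.
apply/funext => m; apply: l2sq_ae; [exact: cmeasurableB|apply: cmeasurableB => //|].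
  exact: ((RG _ (gL2 (phi m))).1).1.
have FF := ae_filter_ringOfSetsType mu.
apply: filterS (Rae (phi m)) => x /= yR Rx; congr (_ - _).
by have := yR Rx; rewrite mulN1r => /subr0_eq.
Qed.

End Separation.

(** * Coefficient integrals over the given intervals *)

Section Subinterval.
Context {R : realType}.
Set Implicit Arguments.
Unset Strict Implicit.
Notation mu := (@lebesgue_measure R).

(** [D] is the open interval with possibly one or both endpoints added, whichever kind of interval
    it is. *)
Lemma measurable_between_itv (D : set R) (u v : R) :
  `]u, v[ `<=` D -> D `<=` `[u, v] -> measurable D.
Proof.
move=> sub sup; have mpt x : measurable (D `&` [set x]).
  have [Dx|Dx] := pselect (D x).
    rewrite (_ : D `&` [set x] = [set x]); first exact: measurable_set1.
    by apply/seteqP; split => [y [_ ->]|y ->].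
  rewrite (_ : D `&` [set x] = set0)//; apply/seteqP; split => // y [Dy yx].
  by rewrite /= yx in Dy.
rewrite (_ : D = `]u, v[ `|` (D `&` [set u]) `|` (D `&` [set v])).
  by apply: measurableU; first exact: measurableU.
apply/seteqP; split => [x Dx|x [[/sub|[]]|[]] //].
have := sup _ Dx; rewrite /= !in_itv/= => /andP[ux xv].
have [ux'|xu] := eqVneq u x; first by left; right.
have [xv'|vx] := eqVneq x v; first by right.
by left; left; rewrite !lt_neqAle ux xv xu vx.
Qed.

(** The constant coefficient contributes [cmod C0 * h], and the factor 2 comes from bounding each of
    the two parts by the modulus. *)
Lemma total_coefficient_bound (n : nat) (C0 : R[i]) (p : nat -> R -> R[i])
    (D : set R) (u h A : R) : (0 < n)%N -> 0 <= u -> 0 < h ->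
  (forall x, p 1%N x = C0) -> (forall j, (1 <= j <= n)%N -> L1loc (p j)) ->
  `]u, u + h[ `<=` D -> D `<=` `[u, u + h] ->
  (\int[mu]_(x in D) (\sum_(2 <= j < n.+1) cmod (p j x))%:E < A%:E)%E ->
  mu.-integrable `[u, u + h] (EFin \o (fun x =>
    \sum_(1 <= j < n.+1) (`|part false (p j x)| + `|part true (p j x)|))) /\
  \int[mu]_(x in `[u, u + h])
    (\sum_(1 <= j < n.+1) (`|part false (p j x)| + `|part true (p j x)|)) <=
  2 * (cmod C0 * h + A).
Proof.
move=> n0 u0 h0 p1 pL sub sup DA.
have uh0 : 0 <= u + h by rewrite addr_ge0// ltW.
have uh : u <= u + h by rewrite lerDl ltW.
have sub0 : `[u, u + h] `<=` `[0, u + h] by apply: subset_itv; rewrite bnd_simp.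
have shrink f : mu.-integrable `[0, u + h] f -> mu.-integrable `[u, u + h] f.
  by apply: integrableS => //; exact: measurable_itv.
pose S x := \sum_(2 <= j < n.+1) cmod (p j x).
have Si : mu.-integrable `[u, u + h] (EFin \o S).
  apply: integrable_sumr; first exact: measurable_itv.
  move=> j; rewrite mem_index_iota => /andP[j1 jn]; apply: shrink.
  by apply: L1loc_cmod_integrable => //; apply: pL; lia.
have Ci : mu.-integrable `[u, u + h] (EFin \o (fun=> cmod C0)).
  by apply: shrink; exact: (L1loc_cmod_integrable (@L1loc_cst _ C0)).
have S0 x : 0 <= S x by apply: sumr_ge0 => j _; exact: cmod_ge0.
have mD := measurable_between_itv sub sup.
have SA : \int[mu]_(x in `[u, u + h]) S x <= A.
  have So : mu.-integrable `]u, u + h] (EFin \o S).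
    apply: integrableS Si; [exact: measurable_itv|exact: measurable_itv|].
    by apply: subset_itv; rewrite bnd_simp.
  have Soo : mu.-integrable `]u, u + h[ (EFin \o S).
    apply: integrableS Si; [exact: measurable_itv|exact: measurable_itv|].
    by apply: subset_itv; rewrite bnd_simp.
  rewrite -Rintegral_itv_obnd_cbnd// -Rintegral_itv_bndo_bndc//.
  rewrite /Rintegral -lee_fin fineK; last exact: (integrable_fin_num _ Soo).
  apply: le_trans (ltW DA); apply: ge0_subset_integral => //.
    apply: measurable_funS (measurable_int _ Si) => //; exact: measurable_itv.
  by move=> x _; rewrite lee_fin; exact: S0.
have qi : mu.-integrable `[u, u + h] (EFin \o (fun x =>
    \sum_(1 <= j < n.+1) (`|part false (p j x)| + `|part true (p j x)|))).
  apply: integrable_sumr; first exact: measurable_itv.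
  move=> j; rewrite mem_index_iota => /andP[j1 jn]; apply: shrink.
  have jL : L1loc (p j) by apply: pL; lia.
  have pi beta : mu.-integrable `[0, u + h] (EFin \o (fun x => `|part beta (p j x)|)).
    exact: integrable_norm (L1loc_integrable beta jL uh0).
  by apply: eq_integrable (integrableD _ (pi false) (pi true)) => //; exact: measurable_itv.
split=> //.
have CSi : mu.-integrable `[u, u + h] (EFin \o (fun x => cmod C0 + S x)).
  by apply: eq_integrable (integrableD _ Ci Si) => //; exact: measurable_itv.
apply: (@le_trans _ _ (\int[mu]_(x in `[u, u + h]) (2 * (cmod C0 + S x)))).
  apply: le_Rintegral => //.
    by apply: eq_integrable (integrableZl _ 2 CSi) => // x _ /=; rewrite EFinM.
  move=> x _; rewrite mulrDr mulr_sumr big_ltn//.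
  have le2 z : `|part false z| + `|part true z| <= 2 * cmod z.
    by have := part_le_cmod false z; have := part_le_cmod true z; lra.
  by apply: lerD; [rewrite p1 le2|apply: ler_sum => j _; exact: le2].
rewrite RintegralZl//.
rewrite ler_pM2l// RintegralD//.
apply: lerD => //; rewrite Rintegral_cst; last exact: measurable_itv.
suff muE : mu `[u, u + h] = h%:E by move: muE => /= ->.
by rewrite lebesgue_measure_itv/= lte_fin ltrDl h0 -EFinD addrC addKr.
Qed.

End Subinterval.

(** * From bounded coefficient integrals to a noncompact resolvent *)

Theorem theorem5 (R : realType) (n : nat) (C0 : R[i]) (p : nat -> R -> R[i]) :
  (2 <= n)%N ->
  (forall x, p 1%N x = C0) ->
  (forall j, (2 <= j <= n)%N -> L1loc (p j)) ->
  (exists G : set ((R -> R[i]) * (R -> R[i])),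
      [/\ is_operator G, graphL0 n p `<=` G & compact_resolvent G]) ->
  forall (h : R) (a : nat -> R) (D : nat -> set R),
    0 < h ->
    (forall k, 0 <= a k) ->
    (forall k, `]a k, a k + h[ `<=` D k /\ D k `<=` `[a k, a k + h]) ->
    (forall k l, k != l -> D k `&` D l = set0) ->
    (\int[@lebesgue_measure R]_(x in D k)
        (\sum_(2 <= j < n.+1) cmod (p j x))%:E)%E @[k --> \oo] --> +oo%E.
Proof.
move=> n2 p1 pL2 [G [Gop LG Gc]] h a D h0 a0 DI Ddisj.
have n0 : (0 < n)%N by lia.
have pL j : (1 <= j <= n)%N -> L1loc (p j).
  move=> /andP[j1 jn]; have [j2|j2] := leqP 2 j; first by apply: pL2; rewrite j2.
  have -> : j = 1%N by lia.
  by rewrite (_ : p 1%N = fun=> C0); [exact: L1loc_cst|exact/funext].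
apply/cvgeyPge => A; apply: contrapT => notA.
have freq N : exists2 k, (N <= k)%N &
    (\int[@lebesgue_measure R]_(x in D k) (\sum_(2 <= j < n.+1) cmod (p j x))%:E < A%:E)%E.
  apply: contrapT => hN; apply: notA; exists N => // k /= Nk; rewrite leNgt; apply/negP => lt.
  by apply: hN; exists k.
have [eta [c [eta0 c0 Htest]]] := @test_function R n n0.
pose A1 := `|2 * (cmod C0 * h + A)|.
have hA0 : 0 <= h + A1 / eta := addr_ge0 (ltW h0) (divr_ge0 (normr_ge0 _) (ltW eta0)).
(* Both summands being nonnegative, one number [r] of halvings makes the length at most 1 and the
   coefficient integral at most [eta]. *)
have [r hr] := expr2_small hA0 ltr01.
have r0 : 0 < 2 ^+ r :> R by rewrite exprn_gt0.
pose d := h / 2 ^+ r; have d0 : 0 < d by rewrite divr_gt0.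
have A1eta : 0 <= A1 / eta / 2 ^+ r := divr_ge0 (divr_ge0 (normr_ge0 _) (ltW eta0)) (ltW r0).
rewrite mulrDl -/d in hr.
have d1 : d <= 1 by lra.
have Ar : A1 / 2 ^+ r <= eta.
  have : A1 / eta / 2 ^+ r <= 1 by lra.
  by rewrite mulrAC ler_pdivrMr// mul1r.
have [M HM] := Htest d d0 d1.
have test N : exists z : nat * R * (nat -> R -> R[i]),
    let k := z.1.1 in let v := z.1.2 in let ys := z.2 in
    [/\ (N <= k)%N, a k <= v /\ v + d <= a k + h, D0 n p (ys 0%N) ys,
      bddsupp v (v + d) M (ys 0%N) /\ bddsupp v (v + d) M (lexpr n p ys) &
      forall x, v + d / 4 <= x <= v + 3 * d / 4 -> c <= cmod (ys 0%N x)].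
  have [k Nk kA] := freq N; have [sub sup] := DI k.
  have [qi qA] := total_coefficient_bound n0 (a0 k) h0 p1 pL sub sup kA.
  have [v [av vh vA]] := halving h0 qi (le_trans qA (ler_norm _)) r.
  have v0 : 0 <= v := le_trans (a0 k) av.
  have vd : v < v + d by rewrite ltrDl.
  have PL j beta : (1 <= j <= n)%N -> L1 (window v (v + d) (fun x => part beta (p j x))).
    by move=> jn; apply: L1loc_window => //; [exact: pL|exact: ltW].
  have [|ys [ysD ys0 ysl yc]] := HM p v v0 PL.
    rewrite (Rintegral_windows (p := fun j beta x => part beta (p j x)))//.
    by apply: le_trans Ar; exact: vA.
  by exists (k, v, ys).
have [f fP] := choice test.
(* Each new index is sought beyond the preceding one, so the chosen intervals are pairwise
   distinct. *)
pose Nm m := iter m (fun N => (f N).1.1.+1) 0%N.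
pose k m := (f (Nm m)).1.1; pose v m := (f (Nm m)).1.2; pose ys m := (f (Nm m)).2.
have kmono : {homo k : i j / (i < j)%N}.
  apply: homo_ltn => [? ? ?|m]; first exact: ltn_trans.
  by have [+ _ _ _ _] := fP (Nm m.+1); exact: leq_trans.
apply: (@compact_resolvent_not_separated R n p G ys (c ^+ 2 * (d / 2))) => //.
- by rewrite mulr_gt0 ?exprn_gt0 ?divr_gt0.
- by move=> m; have [] := fP (Nm m).
- move=> lam; exists (2 * (M + (`|part false lam| + `|part true lam|) * M) ^+ 2 * d) => m.
  have [_ _ _ [b0 bl] _] := fP (Nm m).
  have vd : v m < v m + d by rewrite ltrDl.
  have := bddsupp_L2 vd (bddsupp_sub lam bl b0).
  by rewrite [v m + d - v m]addrAC subrr add0r.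
move=> i j ij.
have kij : k i != k j by case: (ltngtP i j) ij => // [/kmono/ltn_eqF->|/kmono/gtn_eqF->].
have [_ [avi vhi] [[im _] _ _ _ _] _ yc] := fP (Nm i).
have [_ [avj vhj] [[jm _] _ _ _ _] [b0 _] _] := fP (Nm j).
rewrite -/(k i) -/(v i) -/(ys i) in avi vhi im yc.
rewrite -/(k j) -/(v j) -/(ys j) in avj vhj jm b0.
(* The squared distance is bounded below on the middle half of the [i]-th subinterval, where the
   [j]-th function vanishes. *)
have -> : d / 2 = v i + 3 * d / 4 - (v i + d / 4) by field.
apply: l2sq_lower => //; [have := a0 (k i); lra|lra|exact: ltW|].
move=> x /andP[x1 x2].
suff xj : ~~ (v j <= x <= v j + d).
  have part_eq0 beta : part beta (ys j 0%N x) = 0 by have [_ -> //] := b0 beta.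
  by have := part_eq0 false; have := part_eq0 true; case: (ys j 0%N x) => s t /= -> ->.
apply/negP => /andP[x3 x4].
have [subi _] := DI (k i); have [subj _] := DI (k j).
(* If the subintervals met at [x], the two open intervals would overlap, since [x] is interior to
   the first; [z] is the midpoint of their overlap. This excludes merely shared endpoints. *)
pose z := (a (k i) + a (k j) + h) / 2.
have : (D (k i) `&` D (k j)) z.
  by split; [apply: subi|apply: subj]; rewrite /= in_itv/= /z; apply/andP; split; lra.
by rewrite Ddisj.
Qed.
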